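(* Let $p$ be a probability distribution on $\mathbb{R}_+\times\mathbb{R}_+$ with bounded support, and let $\mathcal I=\langle(\ell_t,r_t)\rangle_{t=1}^n$ consist of $n$ i.i.d. samples from $p$; let $\bar\ell=\mathrm{E}[\ell_t]$ and $\bar r=\mathrm{E}[r_t]$, and assume $\bar\ell>0$ and $\bar r>0$. Then there are online algorithms $A$ for $\mathrm{BMC}_{\le K}$ and $B$ for $\textsc{linear}$ $\mathrm{BMC}$ (each asymptotically 1-competitive in expectation) such that, as $n\to\infty$, \[\mathrm{E}[A(\mathcal I)]\sim\mathrm{E}[\mathrm{OPT}(\mathcal I)]\sim \bar\ell\,K\,n^{1+1/K}/c_K,\qquad c_K=(K+1)/(K!)^{1/K}\] (with $\mathrm{OPT}$ for $\mathrm{BMC}_{\le K}$; note $c_K\to e$ as $K\to\infty$), and \[\mathrm{E}[B(\mathcal I)]\sim\mathrm{E}[\mathrm{OPT}(\mathcal I)]\sim \beta\,n\log_2 n\] (with $\mathrm{OPT}$ for $\textsc{linear}$ $\mathrm{BMC}$), where $\beta>0$ satisfies $2^{-\bar\ell/\beta}+2^{-\bar r/\beta}=1$, so that $\beta=\Theta\big((\bar\ell+\bar r)/\ln(1+\max(\bar\ell/\bar r,\bar r/\bar\ell))\big)$.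
   Context: $\mathrm{BMC}_f$ for non-decreasing $f:\mathbb{R}_+\to\mathbb{R}_+\cup\{\infty\}$: input $\langle(\ell_t,r_t)\rangle_{t=1}^n$ of pairs of nonnegative reals revealed one per time step. An algorithm maintains a stack of lengths, initially empty. At time $t$, $\ell_t$ is pushed on top; then the algorithm replaces a nonempty contiguous sequence of lengths at the top of the stack by their sum $L_t$. Cost: $\sum_{t=1}^n L_t+r_tf(k_t)$, $k_t$ the stack size after the compaction at time $t$. $\mathrm{OPT}(\mathcal I)$ is the minimum cost over all schedules. $\mathrm{BMC}_{\le K}$: $f(k)=0$ for $k\le K$, $f(k)=\infty$ for $k>K$ ($K\ge1$ a fixed integer). $\textsc{linear}$ $\mathrm{BMC}$: $f(k)=k$. An algorithm is online if its choice at time $t$ depends only on the first $t$ pairs. $X\sim Y$ means $X=(1\pm o(1))Y$ as $n\to\infty$ (the distribution $p$ fixed). Asymptotically 1-competitive in expectation means $\mathrm{E}[A(\mathcal I)]\sim\mathrm{E}[\mathrm{OPT}(\mathcal I)]$. *)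

(* Defs.v *)
From HB Require Import structures.
From mathcomp Require Import all_boot all_order all_algebra.
From mathcomp Require Import all_classical all_reals all_analysis.

Set Implicit Arguments.
Unset Strict Implicit.
Unset Printing Implicit Defensive.
Import Order.TTheory GRing.Theory Num.Theory.
Import numFieldNormedType.Exports.
Local Open Scope classical_set_scope.
Local Open Scope ring_scope.

Section BMC.
Variable R : realType.
Implicit Types (f : nat -> \bar R) (I : seq (R * R)) (s : seq R) (js : seq nat).

(* A stack is a list of lengths, top first.  [compact l j s] pushes [l] on [s]
   and replaces the [j] topmost lengths by their sum. *)
Definition compact (l : R) (j : nat) s : seq R :=
  (\sum_(x <- take j (l :: s)) x) :: drop j (l :: s).

(* A schedule is given by the numbers of lengths compacted at the successive
   time steps; [k] is the size of the stack before the first of these steps. *)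
Fixpoint is_schedule (k : nat) js : bool :=
  if js is j :: js' then
    (0 < j <= k.+1)%N && is_schedule (k.+2 - j) js'
  else true.

(* The product r * f(k), where f(k) = +oo forbids stack size k even if r = 0
   (the library's product has 0 * +oo = 0). *)
Definition read_cost f (r : R) (k : nat) : \bar R :=
  (if f k == +oo then +oo else r%:E * f k)%E.

(* The input and the schedule are meant to have the same length. *)
Fixpoint cost_from f s I js : \bar R :=
  match I, js with
  | (l, r) :: I', j :: js' =>
      let s' := compact l j s in
      ((head 0%R s')%:E + read_cost f r (size s') + cost_from f s' I' js')%E
  | _, _ => 0%E
  end.

Definition cost f I js : \bar R := cost_from f [::] I js.

(* The entries of a schedule for n steps never exceed n. *)
Definition OPT f I : \bar R :=
  \big[Order.min/+oo%E]_(js : (size I).-tuple 'I_(size I).+1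
                         | is_schedule 0 [seq val j | j <- js])
    cost f I [seq val j | j <- js].

Definition f_atmost (K k : nat) : \bar R := if (k <= K)%N then 0%E else +oo%E.
Definition f_linear (k : nat) : \bar R := k%:R%:E.

Definition schedule_of (choice : seq (R * R) -> nat) I : seq nat :=
  [seq choice (take t.+1 I) | t <- iota 0 (size I)].

(* [choice] maps the pairs revealed so far to the number of lengths to compact.
   It is not given the total number of steps; it is measurable, so that the
   expected cost makes sense. *)
Record online_algorithm := OnlineAlgorithm {
  choice :> seq (R * R) -> nat ;
  choice_valid : forall I, is_schedule 0 (schedule_of choice I) ;
  choice_measurable : forall t,
    measurable_fun [set: t.-tuple (R * R)] (fun x : t.-tuple (R * R) => choice x)
}.

Definition alg_cost f (A : online_algorithm) I : \bar R :=
  cost f I (schedule_of A I).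

Definition nonneg_bounded_support (p : probability (R * R)%type R) : Prop :=
  p [set x | 0 <= x.1 /\ 0 <= x.2] = 1%E /\
  exists M : R, p [set x | `|x.1| <= M /\ `|x.2| <= M] = 1%E.

Definition iid_sample d (Omega : measurableType d) (P : probability Omega R)
    (p : probability (R * R)%type R) (n : nat)
    (X : 'I_n -> Omega -> R * R) : Prop :=
  [/\ forall t, measurable_fun [set: Omega] (X t),
      forall t (B : set (R * R)), measurable B -> P (X t @^-1` B) = p B
    & forall (J : {set 'I_n}) (B : 'I_n -> set (R * R)),
        (forall t, measurable (B t)) ->
        P (\bigcap_(t in [set` J]) X t @^-1` B t) =
        (\prod_(t in J) P (X t @^-1` B t))%E].

Definition asymp_equiv (u v : nat -> \bar R) : Prop :=
  forall e : R, 0 < e -> \forall n \near \oo,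
    ((1 - e)%:E * v n <= u n <= (1 + e)%:E * v n)%E.

(* E[A(I)] ~ E[OPT(I)] ~ g(n), where for every n the input I consists of n
   i.i.d. samples from p on an arbitrary probability space (Omega n, P n). *)
Definition expected_cost_asymp (p : probability (R * R)%type R)
    f (A : online_algorithm) (g : nat -> R) : Prop :=
  forall (d : nat -> measure_display) (Omega : forall n, measurableType (d n))
    (P : forall n, probability (Omega n) R)
    (X : forall n, 'I_n -> Omega n -> R * R),
  (forall n, iid_sample (P n) p (X n)) ->
  let I n w := tval [tuple X n t w | t < n] in
  let EA n := (\int[P n]_w alg_cost f A (I n w))%E in
  let EOPT n := (\int[P n]_w OPT f (I n w))%E in
  asymp_equiv EA EOPT /\ asymp_equiv EOPT (fun n => (g n)%:E).

Definition c_ (K : nat) : R := K.+1%:R / (K`!%:R `^ K%:R^-1).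

Definition log2 (x : R) : R := ln x / ln 2.

Definition is_beta (l r beta : R) : Prop :=
  0 < beta /\ 2 `^ (- (l / beta)) + 2 `^ (- (r / beta)) = 1.

End BMC.

(* Main.v *)
Require Import Defs.
From mathcomp Require Import all_boot all_order all_algebra.
From mathcomp Require Import all_classical all_reals all_analysis.
From mathcomp Require Import measurable_realfun.
From mathcomp Require Import zify ring lra.
Import Order.TTheory GRing.Theory Num.Theory.
Import numFieldNormedType.Exports.
Local Open Scope classical_set_scope.
Local Open Scope ring_scope.

Set Implicit Arguments.
Unset Strict Implicit.
Unset Printing Implicit Defensive.

(** A schedule is a binary tree on the time steps in symmetric order, its root
    being the last time at which the stack has size 1.  A root at step s of an
    interval [a, b] costs the lengths of [a, s], and (for the linear cost) the
    read rates of [s, b]; the two subtrees pay for the rest, the right one with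
    a stack that is deeper by one.

    Upper bounds: both algorithms ignore the data and follow an infinite tree,
    the union of finite trees each of which is the left subtree of the next
    one; so the expected cost is the cost for the constant input (l, r).
    For stack size at most K these are the trees T(K, m) with left subtree
    T(K, m - 1), right subtree T(K - 1, m), and C(m + K, K) - 1 nodes.
    For the linear cost they contain all nodes whose left and right depths i, j
    satisfy i l + j r <= y; there are at least 2^(y / beta) - 1 of them.

    Lower bounds: for constant inputs the recursion gives
    l (m (n + 1) - C(m + K, K + 1)) for every m in the first case, and
    beta (n + 1) log2 (n + 1) in the second one, by Gibbs' inequality.
    For random inputs, let c < l.  The lengths of [a, s] add up to at least
    c (s - a + 1) minus a deficit D(s) that does not depend on a, and the
    expectation of D(s) is bounded because the random walk with steps
    c - l_i has negative drift.  So the random input costs at most a term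
    O(n) less than the constant input c; the same holds for the read rates. *)

(** * Schedules as binary trees *)

Lemma compact_rcons (R : realType) (l b : R) (j : nat) (s : seq R) :
  (j <= (size s).+1)%N -> Defs.compact l j (rcons s b) = rcons (Defs.compact l j s) b.
Proof.
move=> js; rewrite /Defs.compact -rcons_cons.
by rewrite -cats1 takel_cat ?drop_cat/= ?cats1 //; case: ltnP js => //= h1 h2;
  rewrite (_ : j = (size s).+1) ?subnn ?drop0 -?rcons_cat ?drop_oversize//; lia.
Qed.

Lemma size_compact (R : realType) (l : R) (j : nat) (s : seq R) :
  (j <= (size s).+1)%N -> size (Defs.compact l j s) = ((size s).+2 - j)%N.
Proof. by move=> jk; rewrite /= size_drop /=; lia. Qed.

Lemma compact_all (R : realType) (l : R) (s : seq R) :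
  Defs.compact l (size s).+1 s = [:: l + \sum_(x <- s) x].
Proof. by rewrite /Defs.compact /= take_size drop_size big_cons. Qed.

Lemma sum_compact (R : realType) (l : R) (j : nat) (s : seq R) :
  \sum_(x <- Defs.compact l j s) x = l + \sum_(x <- s) x.
Proof. by rewrite /Defs.compact big_cons -big_cat cat_take_drop big_cons. Qed.

Lemma read_cost_ge0 (R : realType) (f : nat -> \bar R) (r : R) (k : nat) :
  (forall k, (0 <= f k)%E) -> 0 <= r -> (0 <= read_cost f r k)%E.
Proof.
by move=> f0 r0; rewrite /read_cost; case: ifPn => // _; rewrite mule_ge0 ?lee_fin.
Qed.

(** Validity of [js] for the stack without [b] means that no compaction ever reaches [b]. So [b] is
    never part of a compacted sum and only makes the stack deeper by one. *)
Lemma cost_from_rcons (R : realType) (f : nat -> \bar R) (b : R) I :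
  forall s js, is_schedule (size s) js ->
  cost_from f (rcons s b) I js = cost_from (f \o S) s I js.
Proof.
elim: I => [|[l r] I IH] s [|j js] //.
move=> /= /andP[/andP[j0 jk] js']; rewrite -!/(Defs.compact _ _ _).
have E := compact_rcons l b jk.
have [-> ->] : \sum_(x <- take j (l :: rcons s b)) x = \sum_(x <- take j (l :: s)) x
    /\ size (drop j (l :: rcons s b)) = (size (drop j (l :: s))).+1.
  by move: E; rewrite /Defs.compact rcons_cons => -[-> ->]; rewrite size_rcons.
by rewrite E IH ?size_compact.
Qed.

(** The root is the last step that leaves a single length on the stack. Induction on the input needs
    an arbitrary initial stack [s], and then there may be no root: either nothing is left at all, or
    the bottom length of [s] is never compacted. If there is a root, the steps after it run above
    one untouched length, whence [f \o S]. *)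
Lemma cost_from_root (R : realType) (f : nat -> \bar R) I :
  forall s js, is_schedule (size s) js -> size js = size I ->
  s = [::] /\ I = [::] \/
  (exists t b, s = rcons t b /\ is_schedule (size t) js) \/
  exists I1 x I2 js1 js2, [/\ I = I1 ++ x :: I2, is_schedule (size s) js1,
    is_schedule 0 js2, size js1 = size I1 /\ size js2 = size I2 &
    cost_from f s I js =
      (cost_from f s I1 js1 +
       ((\sum_(y <- s) y + \sum_(y <- I1) y.1 + x.1)%:E + read_cost f x.2 1 +
        cost (f \o S) I2 js2))%E].
Proof.
elim: I => [|[l r] I IH] s [|j js] //=.
  case/lastP: s => [|t b] _ _; first by left.
  by right; left; exists t, b.
move=> /andP[/andP[j0 jk] jsV] [sz].
(* If this step compacts the whole stack, it is the root unless the resulting single length is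
   compacted again; in that case the induction hypothesis provides a later root. *)
have [jl|jl] := leqP (size s).+1 j.
  have {jl}jE : j = (size s).+1 by lia.
  subst j; right; right.
  have E1 : Defs.compact l (size s).+1 s = [:: l + \sum_(x <- s) x] := compact_all l s.
  have E2 : \sum_(x <- take (size s).+1 (l :: s)) x = l + \sum_(x <- s) x.
    by case: E1.
  rewrite E1 E2 /=.
  have {}jsV : is_schedule (size [:: l + \sum_(x <- s) x]) js.
    by move: jsV; rewrite (_ : ((size s).+2 - (size s).+1)%N = 1%N)//; lia.
  have [[]//|[[t [b [E H]]]|]] := IH _ _ jsV sz.
    case: t E H => [E H|? [] //].
    exists [::], (l, r), I, [::], js; split => //=.
    rewrite drop_size big_nil addr0 add0e (addrC _ l).
    by rewrite (@cost_from_rcons _ f (l + \sum_(x <- s) x) I [::]).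
  move=> [I1 [x [I2 [js1 [js2 [-> V1 V2 [S1 S2] ->]]]]]].
  exists ((l, r) :: I1), x, I2, ((size s).+1 :: js1), js2; split => //=.
  - by rewrite leqnn /= (_ : ((size s).+2 - (size s).+1)%N = 1%N)//; lia.
  - by rewrite S1 S2.
  - rewrite drop_size !big_cons big_nil /= addr0 -!addeA; congr (_ + (_ + (_ + (_ + _))))%E.
    + by rewrite take_size.
    + by rewrite E1.
    + by congr EFin; lra.
rewrite -(size_compact l jk) in jsV.
have [[]//|[|]] := IH _ _ jsV sz.
  case/lastP: s jk jl jsV => [|t b]; first by move=> /=; lia.
  rewrite size_rcons => jk jl jsV [t' [b' [E V]]].
  right; left; exists t, b; split=> //.
  move: E; rewrite compact_rcons; last by lia.
  move/rcons_inj => [E _]; rewrite -(@size_compact _ l j t) ?E ?V; last by lia.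
  by rewrite j0 /=; lia.
move=> [I1 [x [I2 [js1 [js2 [-> V1 V2 [S1 S2] E]]]]]].
right; right; exists ((l, r) :: I1), x, I2, (j :: js1), js2; split => //=.
- by rewrite j0 jk -(size_compact l jk) V1.
- by rewrite S1 S2.
- rewrite E -!addeA; congr (_ + (_ + (_ + (_ + _))))%E.
  congr EFin; rewrite big_cons /=; rewrite !addrA; congr (_ + _ + _).
  by rewrite sum_compact addrC.
Qed.

Lemma cost_root (R : realType) (f : nat -> \bar R) I js :
  is_schedule 0 js -> size js = size I -> I != [::] ->
  exists I1 x I2 js1 js2, [/\ I = I1 ++ x :: I2, is_schedule 0 js1,
    is_schedule 0 js2, size js1 = size I1 /\ size js2 = size I2 &
    cost f I js =
      (cost f I1 js1 +
       ((\sum_(y <- I1) y.1 + x.1)%:E + read_cost f x.2 1 +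
        cost (f \o S) I2 js2))%E].
Proof.
move=> V sz I0; have [[_ E]|[|]] := @cost_from_root _ f I [::] js V sz.
- by rewrite E in I0.
- by move=> [[|? ?] [b []]].
- move=> [I1 [x [I2 [js1 [js2 [E V1 V2 [S1 S2]]]]]]].
  by rewrite big_nil add0r => H; exists I1, x, I2, js1, js2; split.
Qed.

Inductive tree := Leaf | Node of tree & tree.

Fixpoint tsize t := if t is Node a b then (tsize a + tsize b).+1%N else 0%N.

(** The schedule of a tree leaves one length on the stack per node of the right spine, so the root
    that follows a left subtree [a] compacts [(right_spine a).+1] lengths: those left by [a] and its
    own. *)
Fixpoint right_spine t := if t is Node _ b then (right_spine b).+1 else 0%N.

Fixpoint tree_schedule t : seq nat :=
  if t is Node a b then
    tree_schedule a ++ (right_spine a).+1 :: tree_schedule b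
  else [::].

Lemma size_tree_schedule t : size (tree_schedule t) = tsize t.
Proof. by elim: t => //= a IHa b IHb; rewrite size_cat/= IHa IHb addnS. Qed.

(** A schedule stopped after [n] steps is again a tree schedule: a root that comes too late is
    replaced by its left subtree. This gives the cost of an algorithm that does not know [n] in
    advance. *)
Fixpoint prefix_tree t n : tree :=
  if t is Node a b then
    if (n <= tsize a)%N then prefix_tree a n
    else Node a (prefix_tree b (n - (tsize a).+1)%N)
  else Leaf.

Lemma tsize_prefix t n : (n <= tsize t)%N -> tsize (prefix_tree t n) = n.
Proof.
elim: t n => [|a IHa b IHb] n /=; first by rewrite leqn0 => /eqP.
move=> hn; case: leqP => h; [exact: IHa | rewrite /= IHb; lia].
Qed.

Lemma tree_schedule_prefix t n : (n <= tsize t)%N ->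
  tree_schedule (prefix_tree t n) = take n (tree_schedule t).
Proof.
elim: t n => [|a IHa b IHb] n //= hn.
rewrite take_cat size_tree_schedule; case: ltngtP => h.
- by rewrite IHa // ltnW.
- rewrite /= IHb; last by lia.
  by rewrite (_ : (n - tsize a = (n - (tsize a).+1).+1)%N) //; lia.
- by rewrite h subnn take0 cats0 IHa // take_oversize ?size_tree_schedule.
Qed.

Fixpoint stack_size (k : nat) (js : seq nat) : nat :=
  if js is j :: js' then stack_size (k.+2 - j) js' else k.

Lemma is_schedule_cat k js1 js2 :
  is_schedule k (js1 ++ js2) =
  is_schedule k js1 && is_schedule (stack_size k js1) js2.
Proof. by elim: js1 k => //= j js1 IH k; rewrite IH andbA. Qed.

Lemma stack_size_cat k js1 js2 :
  stack_size k (js1 ++ js2) = stack_size (stack_size k js1) js2.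
Proof. by elim: js1 k => /=. Qed.

Lemma tree_schedule_valid t k :
  is_schedule k (tree_schedule t) /\
  stack_size k (tree_schedule t) = (right_spine t + k)%N.
Proof.
elim: t k => [|a IHa b IHb] k //=.
have [Va Wa] := IHa k.
rewrite is_schedule_cat stack_size_cat Va Wa /=.
have -> : ((right_spine a + k).+2 - (right_spine a).+1 = k.+1)%N by lia.
by have [-> ->] := IHb k.+1; split; lia.
Qed.

Lemma size_valid_le k js : is_schedule k js -> all (fun j => j <= k + size js)%N js.
Proof.
elim: js k => //= j js IH k /andP[/andP[j0 jk]] /IH /allP H.
apply/andP; split; first by lia.
by apply/allP => i /H; lia.
Qed.

Fixpoint final_stack (R : realType) (s : seq R) (I : seq (R * R)) (js : seq nat) :=
  match I, js with
  | (l, _) :: I', j :: js' => final_stack (Defs.compact l j s) I' js'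
  | _, _ => s
  end.

Lemma cost_from_cat (R : realType) (f : nat -> \bar R) s I1 I2 js1 js2 :
  size I1 = size js1 ->
  cost_from f s (I1 ++ I2) (js1 ++ js2) =
  (cost_from f s I1 js1 + cost_from f (final_stack s I1 js1) I2 js2)%E.
Proof.
elim: I1 js1 s => [|[l r] I1 IH] [|j js1] s //=; first by rewrite add0e.
by move=> [sz]; rewrite -!/(Defs.compact _ _ _) IH// -!addeA.
Qed.

Lemma sum_final_stack (R : realType) (s : seq R) I js : size I = size js ->
  \sum_(x <- final_stack s I js) x = \sum_(x <- s) x + \sum_(x <- I) x.1.
Proof.
elim: I js s => [|[l r] I IH] [|j js] s //= => [_|[sz]].
  by rewrite big_nil addr0.
by rewrite IH // sum_compact big_cons /= addrA [l + _]addrC.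
Qed.

Lemma size_final_stack (R : realType) (s : seq R) I js : size I = size js ->
  is_schedule (size s) js -> size (final_stack s I js) = stack_size (size s) js.
Proof.
elim: I js s => [|[l r] I IH] [|j js] s //= [sz] /andP[/andP[j0 jk] V].
by rewrite IH ?size_compact.
Qed.

(** Counterpart of [cost_root] for the schedule of a given tree. The root finds exactly the lengths
    left by [a], and these add up to all lengths of [I1]. *)
Lemma cost_tree_node (R : realType) (f : nat -> \bar R) a b I1 x I2 :
  size I1 = tsize a ->
  cost f (I1 ++ x :: I2) (tree_schedule (Node a b)) =
  (cost f I1 (tree_schedule a) +
    ((\sum_(y <- I1) y.1 + x.1)%:E + read_cost f x.2 1 +
        cost (f \o S) I2 (tree_schedule b)))%E.
Proof.
move=> sz; have [Va Wa] := tree_schedule_valid a 0.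
rewrite /cost /= cost_from_cat ?size_tree_schedule//.
have szF := size_final_stack (s := [::]) (etrans sz (esym (size_tree_schedule a))) Va.
rewrite Wa addn0 in szF.
case: x => l r /=.
have := compact_all l (final_stack [::] I1 (tree_schedule a)).
rewrite sum_final_stack ?size_tree_schedule // big_nil add0r szF => E.
case: (E) => -> D; rewrite -!/(Defs.compact _ _ _) E D /=.
rewrite [l + _]addrC; congr (_ + (_ + _))%E.
by rewrite (@cost_from_rcons _ f _ I2 [::]) //; case: (tree_schedule_valid b 0).
Qed.

(** * Lower bounds for arbitrary inputs *)

Lemma cost_from_ge0 (R : realType) (f : nat -> \bar R) I :
  (forall k, (0 <= f k)%E) ->
  forall s js, all (fun x : R * R => (0 <= x.1) && (0 <= x.2)) I ->
  all (fun x => 0 <= x) s -> (0 <= cost_from f s I js)%E.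
Proof.
move=> f0; elim: I => [|[l r] I IH] s [|j js] //=.
move=> /andP[/andP[/= l0 r0] I0] s0.
have s0' : all (fun x => 0 <= x) (l :: s) by rewrite /= l0.
rewrite -(cat_take_drop j (l :: s)) all_cat in s0'.
have /andP[t0 d0] := s0'.
have sum0 : 0 <= \sum_(x <- take j (l :: s)) x.
  by rewrite big_seq sumr_ge0 // => x; move/allP: t0; apply.
by rewrite !adde_ge0 ?lee_fin ?read_cost_ge0 ?IH //= sum0.
Qed.

Lemma f_linear_ge0 (R : realType) k : (0 <= f_linear R k)%E.
Proof. by rewrite lee_fin. Qed.

Lemma f_atmost_ge0 (R : realType) K k : (0 <= f_atmost R K k)%E.
Proof. by rewrite /f_atmost; case: ifP => // _; rewrite leey. Qed.

(** Lengths and rates are functions of absolute time, so that the inputs of both subtrees have the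
    same form and a deficit can be attached to a time step once and for all. *)
Definition input (R : realType) (l r : nat -> R) a n : seq (R * R) :=
  [seq (l i, r i) | i <- iota a n].

Lemma cost_input_ge0 (R : realType) (f : nat -> \bar R) l r a n js :
  (forall k, (0 <= f k)%E) -> (forall i, 0 <= l i) -> (forall i, 0 <= r i) ->
  (0 <= cost f (input l r a n) js)%E.
Proof.
move=> f0 l0 r0; apply: cost_from_ge0 => //.
by apply/allP => _ /mapP[i _ ->] /=; rewrite l0 r0.
Qed.

Lemma cost_input_root (R : realType) (f : nat -> \bar R) (l r : nat -> R) a n js :
  is_schedule 0 js -> size js = n.+1 ->
  exists s js1 js2, [/\ (s <= n)%N, is_schedule 0 js1 /\ is_schedule 0 js2,
    size js1 = s, size js2 = (n - s)%N &
    cost f (input l r a n.+1) js =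
      (cost f (input l r a s) js1 +
       ((\sum_(a <= i < (a + s).+1) l i)%:E + read_cost f (r (a + s)%N) 1 +
        cost (f \o S) (input l r (a + s).+1 (n - s)) js2))%E].
Proof.
move=> V sz.
have [||I1 [x [I2 [js1 [js2 [E V1 V2 [S1 S2] ->]]]]]] :=
    @cost_root _ f (input l r a n.+1) js V => //.
  by rewrite sz size_map size_iota.
have szI : (size I1 + size I2 = n)%N.
  move: (congr1 size E); rewrite size_cat /= size_map size_iota; lia.
have EI : input l r a n.+1 = input l r a (size I1) ++
    (l (a + size I1)%N, r (a + size I1)%N) :: input l r (a + size I1).+1 (n - size I1).
  rewrite /input -[RHS]/(_ ++ [seq (l i, r i) |
    i <- (a + size I1)%N :: iota (a + size I1).+1 (n - size I1)]).
  rewrite -map_cat -[_ :: _]/(iota (a + size I1) (n - size I1).+1) -iotaD.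
  by congr map; congr iota; lia.
move: E; rewrite EI => /eqP; rewrite eqseq_cat ?size_map ?size_iota //.
move=> /andP[/eqP E1 /eqP[Ex E2]].
exists (size I1), js1, js2; split => //; [lia|lia|].
rewrite -{1}E1 -Ex -E2 /=; congr (_ + (_%:E + _ + _))%E.
rewrite big_nat_recr ?leq_addr //= -{1}E1 /input big_map.
by congr (_ + _); rewrite /index_iota (_ : (a + size I1 - a = size I1)%N) //; lia.
Qed.

Lemma leq_bin_diag m K : (m <= 'C(m + K, K.+1))%N.
Proof.
elim: K => [|K IH]; first by rewrite addn0 bin1.
by rewrite addnS binS (leq_trans IH) // leq_addl.
Qed.

(** Induction on the root [s]: the left part is bounded with the same stack size and [m - 1], the
    right part with one level less and the same [m]. The root itself pays [c] times the length of
    [[a, s]], which raises [m - 1] to [m] for the left part, and Pascal's rule adds up the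
    binomials. Every time step is a root exactly once, so each deficit is counted once. *)
Lemma cost_atmost_ge (R : realType) (l r D : nat -> R) c K a n m js :
  (forall i, 0 <= l i) -> (forall i, 0 <= r i) -> (forall i, 0 <= D i) -> 0 <= c ->
  (forall a s, (a <= s)%N ->
    c * (s.+1 - a)%N%:R <= \sum_(a <= i < s.+1) l i + D s) ->
  is_schedule 0 js -> size js = n ->
  ((c * (m%:R * n.+1%:R - 'C(m + K, K.+1)%:R) - \sum_(a <= s < a + n) D s)%:E
     <= cost (f_atmost R K) (input l r a n) js)%E.
Proof.
move=> l0 r0 D0 c0 H.
have sumD0 a' n' : 0 <= \sum_(a' <= s < n') D s by apply: sumr_ge0.
elim/ltn_ind: n K a m js => -[|n] IH K a m js V sz.
  rewrite addn0 big_geq // subr0 mulr1 [cost _ _ _](_ : _ = 0%E); last by case: js V sz.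
  rewrite lee_fin -oppr_ge0 -mulrN opprB mulr_ge0 // subr_ge0 ler_nat.
  exact: leq_bin_diag.
have [s [js1 [js2 [sn [V1 V2] S1 S2 ->]]]] := cost_input_root (f_atmost R K) l r a V sz.
have c1 := cost_input_ge0 a s js1 (@f_atmost_ge0 R K) l0 r0.
have c2 := cost_input_ge0 (a + s).+1 (n - s) js2
  (f := f_atmost R K \o S) (fun k => f_atmost_ge0 R K k.+1) l0 r0.
have sl : 0 <= \sum_(a <= i < (a + s).+1) l i by apply: sumr_ge0.
(* With no stack level available, a nonempty interval costs [+oo]. *)
case: K c1 c2 => [|K] c1 c2.
  have nNy (x : \bar R) : (0 <= x -> x != -oo)%E.
    by move=> x0; rewrite gt_eqF // (lt_le_trans ltNy0).
  rewrite /read_cost /=; by rewrite addey // addye ?nNy // addey ?nNy // leey.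
rewrite /read_cost /= mule0 adde0.
(* For [m = 0] the claimed bound is not positive. *)
case: m => [|m].
  rewrite mul0r add0n bin_small // subr0 mulr0 sub0r.
  apply: (@le_trans _ _ 0%E); first by rewrite lee_fin oppr_le0.
  by rewrite adde_ge0 // adde_ge0 // lee_fin.
have h1 := IH s sn K.+1 a m js1 V1 S1.
have h2 := IH (n - s)%N (leq_subr _ _) K (a + s).+1 m.+1 js2 V2 S2.
apply: le_trans (leeD h1 (leeD (lexx _) h2)).
rewrite -!EFinD lee_fin.
have h3 := H a (a + s)%N (leq_addr _ _).
rewrite (_ : ((a + s).+1 - a = s.+1)%N) in h3; last by clear; lia.
have -> : ((a + s).+1 + (n - s) = a + n.+1)%N by move: sn; clear; lia.
have -> : \sum_(a <= s0 < a + n.+1) D s0 =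
   \sum_(a <= s0 < a + s) D s0 + D (a + s)%N + \sum_((a + s).+1 <= s0 < a + n.+1) D s0.
  rewrite (@big_cat_nat _ _ _ (a + s)%N) /=; [|by clear; lia|by move: sn; clear; lia].
  by rewrite (@big_ltn _ _ _ (a + s)%N) ?addrA //; move: sn; clear; lia.
have -> : 'C(m.+1 + K.+1, K.+2)%:R = 'C(m + K.+1, K.+2)%:R + 'C(m.+1 + K, K.+1)%:R :> R.
  by rewrite -natrD addSn binS addSnnS.
have -> : n.+2%:R = s.+1%:R + (n - s).+1%:R :> R.
  by rewrite -natrD; congr _%:R; move: sn; clear; lia.
rewrite -(natr1 m); lra.
Qed.

Lemma cost_linear_shift (R : realType) (I : seq (R * R)) s js :
  size js = size I ->
  cost_from (@f_linear R \o S) s I js =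
  (cost_from (@f_linear R) s I js + (\sum_(x <- I) x.2)%:E)%E.
Proof.
elim: I s js => [|[l r] I IH] s [|j js] //=; first by rewrite big_nil adde0.
move=> [sz]; rewrite -!/(Defs.compact _ _ _) IH // big_cons EFinD.
have -> k : read_cost (@f_linear R \o S) r k = (read_cost (@f_linear R) r k + r%:E)%E.
  by rewrite /read_cost /f_linear /= -!EFinM -EFinD -natr1 mulrDr mulr1.
by rewrite [X in (X + _)%E = _]addeA addeACA.
Qed.

(** The root pays the lengths of [[a, s]]; its own read and the extra level under the right part
    together pay the rates of [[s, a + n]]. Hence any [Phi] that obeys the resulting recursion as an
    inequality is a lower bound, up to the deficits. The bound [N] confines the forward deficits to
    intervals inside the input. *)
Lemma cost_linear_ge (R : realType) (l r D D' : nat -> R) c d (Phi : nat -> R) N a n js :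
  (forall a s, (a <= s)%N ->
    c * (s.+1 - a)%N%:R <= \sum_(a <= i < s.+1) l i + D s) ->
  (forall s b, (s <= b < N)%N ->
    d * (b.+1 - s)%N%:R <= \sum_(s <= i < b.+1) r i + D' s) ->
  Phi 0%N <= 0 ->
  (forall i j, Phi (i + j).+1 <= c * i.+1%:R + d * j.+1%:R + Phi i + Phi j) ->
  (a + n <= N)%N -> is_schedule 0 js -> size js = n ->
  ((Phi n - \sum_(a <= s < a + n) (D s + D' s))%:E
     <= cost (@f_linear R) (input l r a n) js)%E.
Proof.
move=> Hl Hr P0 PS.
elim/ltn_ind: n a js => -[|n] IH a js aN V sz.
  rewrite addn0 big_geq // subr0 [cost _ _ _](_ : _ = 0%E); last by case: js V sz.
  by rewrite lee_fin.
have [s [js1 [js2 [sn [V1 V2] S1 S2 ->]]]] := cost_input_root (@f_linear R) l r a V sz.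
rewrite /cost cost_linear_shift -/(cost _ _ _); last by rewrite size_map size_iota.
have asN : (a + s <= N)%N by move: sn aN; clear; lia.
have h1 := IH s sn a js1 asN V1 S1.
have sN : ((a + s).+1 + (n - s) <= N)%N by move: sn aN; clear; lia.
have h2 := IH (n - s)%N (leq_subr _ _) (a + s).+1 js2 sN V2 S2.
apply: le_trans (leeD h1 (leeD (lexx _) (leeD h2 (lexx _)))).
rewrite /read_cost /f_linear /= -!EFinM -!EFinD lee_fin mulr1.
have h3 := Hl a (a + s)%N (leq_addr _ _).
rewrite (_ : ((a + s).+1 - a = s.+1)%N) in h3; last by clear; lia.
have h4 := Hr (a + s)%N (a + n)%N ltac:(move: sn aN; clear; lia).
rewrite (_ : ((a + n).+1 - (a + s) = (n - s).+1)%N) in h4; last by move: sn; clear; lia.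
have h5 := PS s (n - s)%N; rewrite subnKC // in h5.
rewrite big_ltn ?ltnS ?leq_add2l // in h4.
have -> : \sum_(x <- input l r (a + s).+1 (n - s)) x.2 =
          \sum_((a + s).+1 <= i < (a + n).+1) r i.
  by rewrite /input big_map /index_iota; congr (bigop _ (iota _ _) _); move: sn; clear; lia.
have -> : ((a + s).+1 + (n - s) = a + n.+1)%N by move: sn; clear; lia.
have -> : \sum_(a <= s0 < a + n.+1) (D s0 + D' s0) =
   \sum_(a <= s0 < a + s) (D s0 + D' s0) + (D (a + s)%N + D' (a + s)%N) +
   \sum_((a + s).+1 <= s0 < a + n.+1) (D s0 + D' s0).
  rewrite (@big_cat_nat _ _ _ (a + s)%N) /=; [|by clear; lia|by move: sn; clear; lia].
  by rewrite (@big_ltn _ _ _ (a + s)%N) ?addrA //; move: sn; clear; lia.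
lra.
Qed.

(** * Tree schedules on constant inputs *)

Lemma prefix_tree_tsize t : prefix_tree t (tsize t) = t.
Proof.
by elim: t => //= a _ b IHb; rewrite leqNgt ltnS leq_addr /= subSS addKn IHb.
Qed.

Definition uniform_cost (R : realType) (f : nat -> \bar R) (l r : R) t : \bar R :=
  cost f (nseq (tsize t) (l, r)) (tree_schedule t).

Lemma uniform_cost_node (R : realType) (f : nat -> \bar R) (l r : R) a b :
  uniform_cost f l r (Node a b) = (uniform_cost f l r a +
    ((l * (tsize a).+1%:R)%:E + read_cost f r 1 + uniform_cost (f \o S) l r b))%E.
Proof.
rewrite /uniform_cost [tsize (Node a b)]/= -addnS nseqD [nseq (tsize b).+1 _]/=.
rewrite cost_tree_node ?size_nseq //= big_nseq iter_addr_0.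
by rewrite -[in RHS]natr1 mulrDr mulr1 mulr_natr.
Qed.

Lemma uniform_cost_linear_shift (R : realType) (l r : R) t :
  uniform_cost (@f_linear R \o S) l r t =
  (uniform_cost (@f_linear R) l r t + (r * (tsize t)%:R)%:E)%E.
Proof.
rewrite /uniform_cost /cost cost_linear_shift ?size_tree_schedule ?size_nseq //.
by rewrite big_nseq iter_addr_0 mulr_natr.
Qed.

(** Each tree is the left subtree of the next one, so the schedules extend each other and together
    define one infinite schedule. *)
Fixpoint left_nested (b : nat -> tree) (m : nat) : tree :=
  if m is m'.+1 then Node (left_nested b m') (b m') else Leaf.

Lemma leq_tsize_left_nested b m : (m <= tsize (left_nested b m))%N.
Proof. by elim: m => //= m IH; rewrite ltnS (leq_trans IH) ?leq_addr. Qed.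

Lemma leq_tsize_left_nested_add b m k :
  (tsize (left_nested b m) <= tsize (left_nested b (k + m)))%N.
Proof.
elim: k => // k IH; rewrite addSn /= (leq_trans IH) //.
by rewrite -addnS leq_addr.
Qed.

Lemma nth_left_nested b m m' i : (m <= m')%N -> (i < tsize (left_nested b m))%N ->
  nth 0%N (tree_schedule (left_nested b m')) i =
  nth 0%N (tree_schedule (left_nested b m)) i.
Proof.
move=> /subnK <-; elim: (m' - m)%N => // k IH im; rewrite addSn /= nth_cat.
rewrite size_tree_schedule IH // ifT // (leq_trans im) //.
exact: leq_tsize_left_nested_add.
Qed.

Fixpoint binomial_tree (K m : nat) : tree :=
  if K is K'.+1 then left_nested (fun i => binomial_tree K' i.+1) m else Leaf.

Lemma tsize_binomial_tree K m : (tsize (binomial_tree K m)).+1 = 'C(m + K, K).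
Proof.
elim: K m => [|K IH] m /=; first by rewrite bin0.
elim: m => [|m IHm] /=; first by rewrite binn.
by rewrite addSn binS -IHm -addSnnS -IH addnS.
Qed.

(** As 'C(m + K, K) is the number of nodes plus one, this value meets the bound of [cost_atmost_ge]
    without deficits: for constant nonnegative inputs these trees are optimal. *)
Lemma uniform_cost_binomial_tree (R : realType) (l r : R) K m :
  uniform_cost (f_atmost R K) l r (binomial_tree K m) =
  (l * (m%:R * 'C(m + K, K)%:R - 'C(m + K, K.+1)%:R))%:E.
Proof.
elim: K m => [|K IH] m /=.
  by rewrite /uniform_cost /cost /= addn0 bin0 bin1 mulr1 subrr mulr0.
elim: m => [|m IHm].
  by rewrite /uniform_cost /cost /= mul0r add0n bin_small // subrr mulr0.
rewrite [left_nested _ _]/= uniform_cost_node IHm.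
rewrite [X in (X + uniform_cost _ _ _ _)%E](_ : _ = (l * 'C(m + K.+1, K.+1)%:R)%:E); last first.
  by rewrite /read_cost /= mule0 adde0 (tsize_binomial_tree K.+1 m).
have -> : uniform_cost (f_atmost R K.+1 \o S) l r (binomial_tree K m.+1) =
  uniform_cost (f_atmost R K) l r (binomial_tree K m.+1) by [].
rewrite IH -!EFinD; congr EFin.
rewrite !addSn !addnS !(binS (m + K).+1) !natrD -(natr1 m); ring.
Qed.

(** A length is paid for at its own node and at every ancestor that has it in its left subtree. Each
    step to the left lowers [m], so this happens at most [m] times. *)
Lemma uniform_cost_prefix_binomial_le (R : realType) (l r : R) K m n : 0 <= l ->
  (n <= tsize (binomial_tree K m))%N ->
  (uniform_cost (f_atmost R K) l r (prefix_tree (binomial_tree K m) n)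
     <= (l * (m%:R * n%:R))%:E)%E.
Proof.
move=> l0; elim: K m n => [|K IH] m n /=.
  by rewrite leqn0 => /eqP ->; rewrite mulr0 mulr0.
elim: m n => [|m IHm] n /=.
  by rewrite leqn0 => /eqP ->; rewrite mulr0 mulr0.
move=> hn; case: leqP => h.
  apply: (le_trans (IHm _ h)); rewrite lee_fin ler_wpM2l // ler_wpM2r ?ler_nat //.
rewrite uniform_cost_node.
set a := left_nested _ _ in h hn *.
have hb : (n - (tsize a).+1 <= tsize (binomial_tree K m.+1))%N.
  by move: hn h; clear; lia.
have h1 := IHm _ (leqnn _); rewrite -/a in h1.
have h2 := IH m.+1 _ hb.
rewrite prefix_tree_tsize in h1.
apply: (le_trans (leeD h1 (leeD (lexx _) h2))).
rewrite /read_cost /= mule0 adde0 -!EFinD lee_fin -!mulrDr ler_wpM2l //.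
rewrite -!natrM -!natrD ler_nat.
move: h; clear; nia.
Qed.

(** The left subtree is complete and its cost is known exactly; only the truncated right subtree is
    estimated by [m.+1] payments per length. The loss turns out to be small enough for the
    asymptotics. *)
Lemma uniform_cost_binomial_prefix_le (R : realType) (l r : R) K m n : 0 <= l ->
  (tsize (binomial_tree K.+1 m) < n <= tsize (binomial_tree K.+1 m.+1))%N ->
  (uniform_cost (f_atmost R K.+1) l r (prefix_tree (binomial_tree K.+1 m.+1) n)
     <= (l * (m.+1%:R * n%:R - 'C(m + K.+1, K.+2)%:R))%:E)%E.
Proof.
move=> l0 /andP[h hn].
rewrite [prefix_tree _ _]/= leqNgt h /= uniform_cost_node.
rewrite (uniform_cost_binomial_tree l r K.+1 m).
have hb : (n - (tsize (binomial_tree K.+1 m)).+1 <= tsize (binomial_tree K m.+1))%N.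
  by rewrite leq_subLR addSn -ltnS.
have h2 := uniform_cost_prefix_binomial_le r l0 hb.
apply: (le_trans (leeD (lexx _) (leeD (lexx _) h2))).
rewrite /read_cost /= mule0 adde0 -!EFinD lee_fin -!mulrDr ler_wpM2l //.
rewrite (natrB _ h) (tsize_binomial_tree K.+1 m) -(natr1 m); lra.
Qed.

(** A step to the left uses up [l] of the budget [y] and a step to the right uses up [r]. The
    argument [fuel] makes the recursion structural; it has to be large enough for the budget to
    become negative first. *)
Fixpoint budget_tree (R : realType) (l r : R) (fuel : nat) (y : R) : tree :=
  if fuel is fuel'.+1 then
    if y < 0 then Leaf else
    Node (budget_tree l r fuel' (y - l)) (budget_tree l r fuel' (y - r))
  else Leaf.

Lemma powR_beta_split (R : realType) (l r beta y : R) :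
  2 `^ (- (l / beta)) + 2 `^ (- (r / beta)) = 1 ->
  2 `^ (y / beta) = 2 `^ ((y - l) / beta) + 2 `^ ((y - r) / beta).
Proof.
move=> bE; rewrite !mulrBl !powRD ?pnatr_eq0 ?implybT // -mulrDr bE.
by rewrite mulr1.
Qed.

(** The number of nodes plus one is 1 for negative [y] and otherwise the sum of its values at
    [y - l] and [y - r]. By the equation for [beta], 2^(y / beta) obeys the same recursion, and it
    is at most 1 for negative [y]. The condition on [mu] ensures that the fuel suffices. *)
Lemma tsize_budget_tree_ge (R : realType) (l r beta mu : R) fuel y :
  0 < beta -> 2 `^ (- (l / beta)) + 2 `^ (- (r / beta)) = 1 ->
  mu <= l -> mu <= r -> y < mu * fuel%:R ->
  2 `^ (y / beta) <= (tsize (budget_tree l r fuel y)).+1%:R.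
Proof.
move=> b0 bE ml mr; elim: fuel y => [|fuel IH] y yf /=.
  rewrite mulr0 in yf; rewrite -[leRHS](powRr0 2) ler_powR ?ler1n //.
  by rewrite ler_pdivrMr // mul0r ltW.
case: ifPn => [y0|y0] /=.
  rewrite -[leRHS](powRr0 2) ler_powR ?ler1n //.
  by rewrite ler_pdivrMr // mul0r ltW.
rewrite (powR_beta_split y bE) -addSn -addnS natrD lerD // IH //;
  rewrite -natr1 in yf; lra.
Qed.

Lemma uniform_cost_linear_node (R : realType) (l r : R) a b :
  uniform_cost (@f_linear R) l r (Node a b) =
  (uniform_cost (@f_linear R) l r a + uniform_cost (@f_linear R) l r b +
   (l * (tsize a).+1%:R + r * (tsize b).+1%:R)%:E)%E.
Proof.
rewrite uniform_cost_node uniform_cost_linear_shift /read_cost /f_linear /=.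
rewrite -EFinM -EFinD -[RHS]addeA; congr (_ + _)%E.
rewrite addeCA -EFinD; congr (_ + _%:E)%E.
by rewrite -[in RHS](natr1 (tsize b)); ring.
Qed.

(** A time step at left depth i and right depth j is charged (i + 1) l + (j + 1) r in total, and i l
    + j r is at most [y]. *)
Lemma uniform_cost_prefix_budget_le (R : realType) (l r : R) fuel y n :
  0 <= l -> 0 <= r -> (n <= tsize (budget_tree l r fuel y))%N ->
  (uniform_cost (@f_linear R) l r (prefix_tree (budget_tree l r fuel y) n)
     <= (n%:R * (y + l + r))%:E)%E.
Proof.
move=> l0 r0; elim: fuel y n => [|fuel IH] y n /=.
  by rewrite leqn0 => /eqP ->; rewrite mul0r.
case: ifPn => [y0 /=|].
  by rewrite leqn0 => /eqP ->; rewrite mul0r.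
rewrite -leNgt => y0 /=.
set a := budget_tree _ _ _ (y - l); set b := budget_tree _ _ _ (y - r) => hn.
case: leqP => h.
  apply: (le_trans (IH _ _ h)); rewrite lee_fin ler_wpM2l //; lra.
rewrite uniform_cost_linear_node tsize_prefix; last first.
  by move: hn h; clear; lia.
have h1 := IH _ _ (leqnn (tsize a)); rewrite prefix_tree_tsize in h1.
have hb : (n - (tsize a).+1 <= tsize b)%N by move: hn h; clear; lia.
have h2 := IH _ _ hb.
apply: (le_trans (leeD (leeD h1 h2) (lexx _))).
rewrite -!EFinD lee_fin.
have -> : n%:R = (tsize a)%:R + (n - (tsize a).+1).+1%:R :> R.
  by rewrite -natrD; congr _%:R; move: h; clear; lia.
rewrite -!natr1; nra.
Qed.

(** With enough fuel and positive [l], this is the budget tree for y = (m - 1) l. Budgets that are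
    multiples of [l] make each tree the left subtree of the next one. *)
Definition linear_tree (R : realType) (l r : R) (fuel : nat -> nat) (m : nat) : tree :=
  left_nested (fun i => budget_tree l r (fuel i) (i%:R * l - r)) m.

Lemma tsize_linear_tree_ge (R : realType) (l r beta mu : R) fuel m :
  0 < beta -> 2 `^ (- (l / beta)) + 2 `^ (- (r / beta)) = 1 ->
  mu <= l -> mu <= r -> 0 <= l ->
  (forall i, i%:R * l - r < mu * (fuel i)%:R) ->
  2 `^ ((m%:R - 1) * l / beta) <= (tsize (linear_tree l r fuel m)).+1%:R.
Proof.
move=> b0 bE ml mr l0 hf; elim: m => [|m IH] /=.
  rewrite -[leRHS](powRr0 2) ler_powR ?ler1n //.
  by rewrite ler_pdivrMr // mul0r sub0r mulN1r oppr_le0.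
rewrite -(natr1 m) addrK (powR_beta_split _ bE) -addSn -addnS natrD lerD //.
  by rewrite -[X in _ - X]mul1r -mulrBl.
exact: tsize_budget_tree_ge (hf m).
Qed.

Lemma uniform_cost_prefix_linear_le (R : realType) (l r : R) fuel m n :
  0 <= l -> 0 <= r -> (n <= tsize (linear_tree l r fuel m))%N ->
  (uniform_cost (@f_linear R) l r (prefix_tree (linear_tree l r fuel m) n)
     <= (n%:R * (m%:R * l + r))%:E)%E.
Proof.
move=> l0 r0; elim: m n => [|m IH] n /=.
  by rewrite leqn0 => /eqP ->; rewrite mul0r.
rewrite -/(linear_tree l r fuel m) => hn; case: leqP => h.
  by apply: (le_trans (IH _ h)); rewrite lee_fin ler_wpM2l // lerD2r ler_wpM2r // ler_nat.
set b := budget_tree _ _ _ _ in hn *.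
have hb : (n - (tsize (linear_tree l r fuel m)).+1 <= tsize b)%N.
  by move: hn h; clear; lia.
rewrite uniform_cost_linear_node tsize_prefix //.
have h1 := IH _ (leqnn _); rewrite prefix_tree_tsize in h1.
have h2 := uniform_cost_prefix_budget_le l0 r0 hb.
apply: (le_trans (leeD (leeD h1 h2) (lexx _))).
rewrite -!EFinD lee_fin.
have -> : n%:R = (tsize (linear_tree l r fuel m))%:R +
    (n - (tsize (linear_tree l r fuel m)).+1).+1%:R :> R.
  by rewrite -natrD; congr _%:R; move: h; clear; lia.
rewrite -!natr1.
set x := (tsize _)%:R; set z := (n - _)%:R.
have : 0 <= m%:R * l by rewrite mulr_ge0.
by lra.
Qed.

(** Only the number of pairs seen so far matters. It also serves as the index of the tree: a
    left-nested tree with index t has at least t nodes, so the required entry exists. *)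
Definition tree_choice (R : realType) (T : nat -> tree) (I : seq (R * R)) : nat :=
  nth 0%N (tree_schedule (T (size I))) (size I).-1.

(** The choices at different times consult different trees of the family, but the schedules of
    nested trees agree wherever both are defined. *)
Lemma schedule_of_left_nested (R : realType) b m (I : seq (R * R)) :
  (size I <= tsize (left_nested b m))%N ->
  schedule_of (tree_choice (left_nested b)) I =
  tree_schedule (prefix_tree (left_nested b m) (size I)).
Proof.
move=> hm; rewrite tree_schedule_prefix //.
apply: (@eq_from_nth _ 0%N).
  by rewrite size_map size_iota size_takel // size_tree_schedule.
rewrite size_map size_iota => i hi.
rewrite (nth_map 0%N) ?size_iota // nth_iota // add0n nth_take //.
rewrite /tree_choice size_takel // /=.
have hi' : (i < tsize (left_nested b i.+1))%N := leq_tsize_left_nested b i.+1.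
have [h|h] := leqP i.+1 m; first by rewrite [RHS](nth_left_nested h).
by rewrite (nth_left_nested (ltnW h)) // (leq_trans hi).
Qed.

Lemma schedule_of_valid (R : realType) b (I : seq (R * R)) :
  is_schedule 0 (schedule_of (tree_choice (left_nested b)) I).
Proof.
rewrite (schedule_of_left_nested (leq_tsize_left_nested b (size I))).
by case: (tree_schedule_valid (prefix_tree (left_nested b (size I)) (size I)) 0).
Qed.

Lemma tree_choice_measurable (R : realType) T t :
  measurable_fun [set: t.-tuple (R * R)] (fun x : t.-tuple (R * R) => tree_choice T x).
Proof.
rewrite (_ : (fun _ => _) = cst (nth 0%N (tree_schedule (T t)) t.-1)).
  exact: measurable_cst.
by apply/funext => x; rewrite /tree_choice size_tuple.
Qed.

Definition tree_algorithm (R : realType) (b : nat -> tree) : online_algorithm R :=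
  OnlineAlgorithm (schedule_of_valid b) (tree_choice_measurable (left_nested b)).

(** * Exponential moments of i.i.d. samples *)

(** Since exp x is at least 1 + x, it suffices that (1 - x + x^2)(1 + x) = 1 + x^3 is at least 1. *)
Lemma expRN_le_quadratic (R : realType) (x : R) : 0 <= x -> expR (- x) <= 1 - x + x ^+ 2.
Proof.
move=> x0; have h := expR_ge1Dx x.
have e0 : 0 < expR x by exact: expR_gt0.
have q0 : 0 <= 1 - x + x ^+ 2 by nra.
rewrite expRN -[leLHS]mul1r ler_pdivrMr //.
have : (1 - x + x ^+ 2) * (1 + x) <= (1 - x + x ^+ 2) * expR x by rewrite ler_wpM2l.
apply: le_trans; have : 0 <= x ^+ 3 by rewrite exprn_ge0.
by rewrite !exprS expr0; lra.
Qed.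

Lemma integral_finite_valued d (T : measurableType d) (R : realType)
    (P : probability T R) N (v : T -> 'I_N) (G : 'I_N -> R) :
  (forall a, measurable (v @^-1` [set a])) -> (forall a, 0 <= G a) ->
  (\int[P]_x (G (v x))%:E = \sum_a (G a)%:E * P (v @^-1` [set a]))%E.
Proof.
move=> mv G0.
transitivity (\int[P]_x (\sum_a (G a)%:E * (\1_(v @^-1` [set a]) x)%:E))%E.
  apply: eq_integral => x _; rewrite (bigD1 (v x)) //= big1 ?adde0.
    by rewrite indicE mem_set //= mule1.
  move=> a /eqP av; rewrite indicE memNset ?mule0 //= => /esym.
  exact: av.
rewrite ge0_integral_sum //=.
- apply: eq_bigr => a _; rewrite ge0_integralZl_EFin //.
    by rewrite integral_indic ?setIT.
  exact/measurable_EFinP.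
- move=> a; apply: emeasurable_funM => //.
  exact/measurable_EFinP.
- by move=> a x _; rewrite mule_ge0 ?lee_fin.
Qed.

Lemma measurable_finite_valued d (T : measurableType d) (R : realType)
    N (G : 'I_N -> R) (v : T -> 'I_N) :
  (forall a, measurable (v @^-1` [set a])) -> measurable_fun setT (G \o v).
Proof.
move=> mv _ Y mY; rewrite setTI.
rewrite (_ : _ @^-1` _ = \bigcup_(a in [set a | Y (G a)]) v @^-1` [set a]).
  by apply: fin_bigcup_measurable => //; exact: finite_finset.
apply/seteqP; split => z /=; first by move=> h; exists (v z).
by move=> [a /= Ya ->].
Qed.

(** The integrand is expanded over all assignments [f] of values to the samples, of which exactly
    one occurs at each sample point. Independence splits the probability of each assignment, and
    distributivity reassembles the product of sums. *)
Lemma integral_prod_finite_valued d (Omega : measurableType d) (R : realType)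
    (P : probability Omega R) (p : probability (R * R)%type R) n
    (X : 'I_n -> Omega -> R * R) N (v : R * R -> 'I_N) (W : 'I_n -> 'I_N -> R) :
  iid_sample P p X ->
  (forall a, measurable (v @^-1` [set a])) -> (forall i a, 0 <= W i a) ->
  (\int[P]_w (\prod_i W i (v (X i w)))%:E =
   \prod_i \sum_a (W i a)%:E * p (v @^-1` [set a]))%E.
Proof.
move=> [mX lawX indepX] mv W0.
have mE (f : {ffun 'I_n -> 'I_N}) :
    measurable (\bigcap_(t in [set` [set: 'I_n]%SET]) X t @^-1` (v @^-1` [set f t])).
  apply: fin_bigcap_measurable => [|t _]; first exact: finite_finset.
  by rewrite -[X in measurable X]setTI; exact: mX.
transitivity (\int[P]_w (\sum_(f : {ffun 'I_n -> 'I_N}) (\prod_i W i (f i))%:E *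
   (\1_(\bigcap_(t in [set` [set: 'I_n]%SET]) X t @^-1` (v @^-1` [set f t])) w)%:E))%E.
  apply: eq_integral => w _; rewrite (bigD1 [ffun i => v (X i w)]) //= [X in (_ + X)%E]big1 ?adde0.
    rewrite indicE mem_set /=; last by move=> t _ /=; rewrite ffunE.
    rewrite mule1.
    by congr EFin; apply: eq_bigr => i _; rewrite ffunE.
  move=> f /eqP fv; rewrite indicE memNset ?mule0 //= => H.
  by apply: fv; apply/ffunP => i; rewrite ffunE; apply/esym/H; rewrite /= inE.
rewrite ge0_integral_sum //=; last 2 first.
- move=> a; apply: emeasurable_funM => //.
  exact/measurable_EFinP.
- by move=> f x _; rewrite mule_ge0 ?lee_fin // prodr_ge0.
transitivity (\sum_(f : {ffun 'I_n -> 'I_N}) 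
   ((\prod_i (W i (f i) * fine (p (v @^-1` [set f i])))%R)%:E))%E.
  apply: eq_bigr => f _; rewrite ge0_integralZl_EFin ?prodr_ge0 //; last first.
    exact/measurable_EFinP.
  rewrite integral_indic // setIT.
  rewrite [X in (_ * X)%E](indepX [set: _]%SET (fun t => v @^-1` [set f t])) //.
  rewrite big_split /= EFinM; congr (_ * _)%E.
  rewrite -prodEFin; apply: eq_big => [i|i _]; first by rewrite inE.
  by rewrite lawX // fineK // fin_num_measure.
rewrite sumEFin -(bigA_distr_bigA (fun i a => W i a * fine (p (v @^-1` [set a])))).
rewrite -prodEFin; apply: eq_bigr => i _.
rewrite -sumEFin; apply: eq_bigr => a _.
by rewrite EFinM fineK // fin_num_measure.
Qed.

(* Discretizing a bounded coordinate makes the exponential moments of its sums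
   factor through the events in the definition of an i.i.d. sample. *)
Lemma exponential_moment (R : realType) (p : probability (R * R)%type R)
    (h : R * R -> R) (M m c : R) :
  measurable_fun setT h -> (forall z, 0 <= h z <= M) ->
  (\int[p]_z (h z)%:E = m%:E)%E -> c < m ->
  exists (theta rho : R) (g : R * R -> R), [/\ 0 < theta, 0 <= rho < 1,
    measurable_fun setT g, (forall z, expR (theta * (c - h z)) <= g z) &
    forall d (Omega : measurableType d) (P : probability Omega R) n
      (X : 'I_n -> Omega -> R * R) (J : {set 'I_n}), iid_sample P p X ->
      (\int[P]_w (\prod_(i in J) g (X i w))%:E = (rho ^+ #|J|)%:E)%E].
Proof.
move=> mh hM hm cm.
have M0 : 0 <= M by case/andP: (hM (0, 0)) => /le_trans; apply.
(* The gap m - c is shared out: rounding down to multiples of [delta] costs at most a quarter of it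
   in the mean, and [theta] is so small that the quadratic term of the exponential costs at most
   another quarter. The summand 1 in the denominator of [theta] covers M = 0. *)
pose delta := (m - c) / 4; have delta0 : 0 < delta by rewrite /delta; lra.
pose theta := (m - c) / (4 * (M ^+ 2 + 1)).
have M2 : 0 <= M ^+ 2 by rewrite sqr_ge0.
have theta0 : 0 < theta by rewrite divr_gt0 //; lra.
have thetaM : theta * M ^+ 2 <= (m - c) / 4.
  rewrite /theta -mulrA ler_pM2l; last lra.
  by rewrite ler_pdivrMl; lra.
pose N := Num.trunc (M / delta).
pose v z : 'I_N.+1 := inord (Num.trunc (h z / delta)).
have hd0 z : 0 <= h z / delta.
  by rewrite divr_ge0 ?(ltW delta0) //; case/andP: (hM z).
have vE z : v z = Num.trunc (h z / delta) :> nat.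
  rewrite inordK // ltnS; apply: le_truncn.
  by rewrite ler_pM2r ?invr_gt0 //; case/andP: (hM z).
have vh z : (v z)%:R * delta <= h z < (v z).+1%:R * delta.
  rewrite -ler_pdivlMr // -ltr_pdivrMr // vE; exact: truncn_itv.
have mv a : measurable (v @^-1` [set a]).
  rewrite (_ : _ @^-1` _ = h @^-1` `[a%:R * delta, a.+1%:R * delta[%classic).
    by rewrite -[X in measurable X]setTI; exact: mh.
  apply/seteqP; split => z /=; rewrite in_itv /=; first by move=> <-.
  move=> /andP[h1 h2]; apply/val_inj; rewrite /= vE.
  by apply/eqP; rewrite truncn_eq // ler_pdivlMr // ltr_pdivrMr // h1 h2.
(* The lower end of the cell stands for [h z], so [G] is at least the exponential that it
   replaces. *)
pose G (a : 'I_N.+1) := expR (theta * (c - a%:R * delta)).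
pose q (a : 'I_N.+1) := fine (p (v @^-1` [set a])).
have qE a : (q a)%:E = p (v @^-1` [set a]) by rewrite fineK // fin_num_measure.
have q0 a : 0 <= q a by rewrite fine_ge0.
have sumq : \sum_(a < N.+1) q a = 1.
  apply/EFin_inj; rewrite -sumEFin.
  have <- : (\int[p]_x (1 : R)%:E = 1%:E)%E.
    by rewrite integral_cst //= probability_setT mule1.
  rewrite (integral_finite_valued p mv (fun=> ler01)).
  by apply: eq_bigr => a _; rewrite mul1e qE.
have mean : m - delta <= \sum_(a < N.+1) a%:R * delta * q a.
  suff : m <= \sum_(a < N.+1) a.+1%:R * delta * q a.
    rewrite (eq_bigr (fun a : 'I_N.+1 => a%:R * delta * q a + delta * q a)); last first.
      by move=> a _; rewrite -natr1; ring.
    by rewrite big_split /= -mulr_sumr sumq; lra.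
  rewrite -lee_fin -hm -sumEFin.
  rewrite (eq_bigr (fun a : 'I_N.+1 => (a.+1%:R * delta)%:E * p (v @^-1` [set a]))%E);
    last by move=> a _; rewrite EFinM qE.
  have W0 (a : 'I_N.+1) : 0 <= a.+1%:R * delta by rewrite mulr_ge0 // ltW.
  rewrite -(integral_finite_valued p mv W0); apply: ge0_le_integral => //.
  - by move=> z _; rewrite lee_fin; case/andP: (hM z).
  - exact/measurable_EFinP.
  - apply/measurable_EFinP; exact: (measurable_finite_valued (fun a : 'I_N.+1 => a.+1%:R * delta)).
  - by move=> z _; rewrite lee_fin; case/andP: (vh z) => _ /ltW.
exists theta, (\sum_(a < N.+1) G a * q a), (G \o v); split => //.
- rewrite sumr_ge0 /=; last by move=> a _; rewrite mulr_ge0 ?expR_ge0.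
  have GE a : G a <= expR (theta * c) * (1 + theta * (theta * M ^+ 2 - a%:R * delta)).
    rewrite /G mulrBr expRD ler_wpM2l ?expR_ge0 //.
    have a0 : 0 <= a%:R * delta by rewrite mulr_ge0 // ltW.
    have aM : a%:R * delta <= M.
      rewrite -ler_pdivlMr // -truncn_ge_nat; last exact: divr_ge0 (ltW _).
      by rewrite -ltnS.
    apply: (le_trans (expRN_le_quadratic _)); first by rewrite mulr_ge0 // ltW.
    rewrite exprMn; have : (a%:R * delta) ^+ 2 <= M ^+ 2 by rewrite lerXn2r.
    move=> /(ler_wpM2l (sqr_ge0 theta)); rewrite expr2; lra.
  apply: (@le_lt_trans _ _ (\sum_(a < N.+1) expR (theta * c) *
      (1 + theta * (theta * M ^+ 2 - a%:R * delta)) * q a)).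
    by apply: ler_sum => a _; rewrite ler_wpM2r.
  have -> : \sum_(a < N.+1) expR (theta * c) * (1 + theta * (theta * M ^+ 2 - a%:R * delta)) * q a =
     expR (theta * c) * (1 + theta * (theta * M ^+ 2 - \sum_(a < N.+1) a%:R * delta * q a)).
    rewrite (eq_bigr (fun a : 'I_N.+1 => expR (theta * c) * (1 + theta * (theta * M ^+ 2)) * q a
       - expR (theta * c) * theta * (a%:R * delta * q a))); last by move=> a _; ring.
    by rewrite sumrB -!mulr_sumr sumq; ring.
  (* The two quarters leave half of the gap: the moment is at most exp(theta (c - m) / 2), which is
     less than 1. *)
  apply: (@le_lt_trans _ _ (expR (theta * c) * expR (theta * ((c - m) / 2 - c)))).
    rewrite ler_wpM2l ?expR_ge0 //; apply: le_trans (expR_ge1Dx _).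
    rewrite lerD2l ler_pM2l //; rewrite /delta in mean thetaM *; lra.
  rewrite -expRD -mulrDr -[ltRHS]expR0 ltr_expR.
  by rewrite pmulr_rlt0 //; lra.
- exact: measurable_finite_valued.
- move=> z; rewrite ler_expR ler_pM2l // lerD2l lerN2.
  by case/andP: (vh z).
move=> d Omega P n X J iidX.
(* Weight 1 outside [J] extends the product to all samples; the additional factors are the total
   mass 1. *)
pose W (i : 'I_n) a := if i \in J then G a else 1.
have W0 i a : 0 <= W i a by rewrite /W; case: ifP => // _; exact: expR_ge0.
transitivity (\int[P]_w (\prod_i W i (v (X i w)))%:E)%E.
  by apply: eq_integral => w _; rewrite big_mkcond.
rewrite (integral_prod_finite_valued iidX mv W0).
transitivity (\prod_(i in J) (\sum_(a < N.+1) G a * q a)%:E)%E.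
  rewrite [RHS]big_mkcond; apply: eq_bigr => i _; rewrite /W; case: ifP => _.
    by rewrite -sumEFin; apply: eq_bigr => a _; rewrite EFinM qE.
  transitivity (\sum_(a < N.+1) q a)%:E; last by rewrite sumq.
  rewrite -sumEFin; apply: eq_bigr => a _.
  by rewrite mul1e qE.
by rewrite prodEFin prodr_const.
Qed.

(** * Measurability and expectation of the cost *)

Lemma cost_from_cons (R : realType) (f : nat -> \bar R) (s : seq R) x I j js :
  cost_from f s (x :: I) (j :: js) =
  ((head 0 (Defs.compact x.1 j s))%:E +
   read_cost f x.2 (size (Defs.compact x.1 j s)) +
   cost_from f (Defs.compact x.1 j s) I js)%E.
Proof. by case: x. Qed.

(** For a fixed schedule the stack is a list of random variables. Compacting these, instead of their
    values at a sample point, allows induction on the input for measurability and integrals. *)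
Definition compact_fun (T : Type) (R : realType) (l : T -> R) j (S : seq (T -> R)) :=
  (fun w => \sum_(g <- take j (l :: S)) g w) :: drop j (l :: S).

Lemma compact_funE (T : Type) (R : realType) (l : T -> R) j (S : seq (T -> R)) w :
  Defs.compact (l w) j [seq g w | g <- S] = [seq g w | g <- compact_fun l j S].
Proof.
rewrite /Defs.compact -[l w :: _]/(map (@^~ w) (l :: S)) -map_take -map_drop.
by rewrite big_map.
Qed.

Lemma cost_from_fun_cons (T : Type) (R : realType) (f : nat -> \bar R)
    (S : seq (T -> R)) (x : T -> R * R) X j js w :
  cost_from f [seq g w | g <- S] [seq y w | y <- x :: X] (j :: js) =
  ((\sum_(g <- take j (fst \o x :: S)) g w)%:E +
   read_cost f (x w).2 (size (compact_fun (fst \o x) j S)) +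
   cost_from f [seq g w | g <- compact_fun (fst \o x) j S] [seq y w | y <- X] js)%E.
Proof.
by rewrite map_cons cost_from_cons (compact_funE (fst \o x)) size_map.
Qed.

Lemma cost_from_nil (R : realType) (f : nat -> \bar R) (s : seq R) I :
  cost_from f s I [::] = 0%E.
Proof. by case: I => // -[]. Qed.

Lemma measurable_big_sum d (T : measurableType d) (R : realType) (S : seq (T -> R)) :
  (forall g, g \in S -> measurable_fun setT g) ->
  measurable_fun setT (fun w => \sum_(g <- S) g w).
Proof.
elim: S => [|h s IHs] H.
  rewrite (_ : (fun _ => _) = cst 0); first exact: measurable_cst.
  by apply/funext => w; rewrite big_nil.
under eq_fun do rewrite big_cons.
apply: measurable_funD; first by apply: H; rewrite mem_head.
by apply: IHs => g gs; apply: H; rewrite inE gs orbT.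
Qed.

Lemma measurable_read_cost d (T : measurableType d) (R : realType)
    (f : nat -> \bar R) (r : T -> R) k :
  measurable_fun setT r -> measurable_fun setT (fun w => read_cost f (r w) k).
Proof.
move=> mr; rewrite /read_cost; case: (f k == +oo%E) => //.
by apply: emeasurable_funM => //; exact/measurable_EFinP.
Qed.

Lemma measurable_cost_from d (T : measurableType d) (R : realType)
    (f : nat -> \bar R) (X : seq (T -> R * R)) js (S : seq (T -> R)) :
  (forall x, x \in X -> measurable_fun setT x) ->
  (forall g, g \in S -> measurable_fun setT g) ->
  measurable_fun setT
    (fun w => cost_from f [seq g w | g <- S] [seq x w | x <- X] js).
Proof.
elim: X js S => [|x X IH] [|j js] S mX mS //.
  rewrite (_ : (fun _ => _) = cst 0%E); first exact: measurable_cst.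
  by apply/funext => w; rewrite cost_from_nil.
have mx : measurable_fun setT x by apply: mX; rewrite mem_head.
have ml : measurable_fun setT (fst \o x) by apply: measurableT_comp.
have mlS g : g \in fst \o x :: S -> measurable_fun setT g.
  by rewrite inE => /predU1P[->|/mS].
have msum : measurable_fun setT
    (fun w => \sum_(g <- take j (fst \o x :: S)) g w).
  apply: measurable_big_sum => g /mem_take; exact: mlS.
under eq_fun => w do rewrite cost_from_fun_cons.
apply: emeasurable_funD; first apply: emeasurable_funD.
- exact/measurable_EFinP.
- by apply: measurable_read_cost; apply: measurableT_comp.
apply: IH => [y yX|g]; first by apply: mX; rewrite inE yX orbT.
by rewrite inE => /predU1P[->|/mem_drop/mlS].
Qed.

Definition mean d (T : measurableType d) (R : realType) (P : probability T R)
  (g : T -> R) : R := fine (\int[P]_w (g w)%:E).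

Lemma integral_read_cost d (T : measurableType d) (R : realType)
    (P : probability T R) (f : nat -> \bar R) (r : T -> R) k :
  (forall k, 0 <= f k)%E -> measurable_fun setT r -> (forall w, 0 <= r w) ->
  (\int[P]_w (r w)%:E)%E \is a fin_num ->
  (\int[P]_w read_cost f (r w) k)%E = read_cost f (mean P r) k.
Proof.
move=> f0 mr r0 fr; rewrite /read_cost; case: ifPn => [_|fk].
  rewrite (_ : (fun _ => _) = cst +oo%E) //.
  by rewrite integral_cst //= probability_setT mule1.
have : (0 <= f k)%E := f0 k; case: (f k) fk => [x _ x0|//|//].
under eq_integral do rewrite muleC.
rewrite ge0_integralZl_EFin //.
- by rewrite muleC /mean fineK.
- by move=> w _; rewrite lee_fin.
- exact/measurable_EFinP.
Qed.

Lemma integral_sum_take d (T : measurableType d) (R : realType)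
    (P : probability T R) (S : seq (T -> R)) :
  (forall g, g \in S -> [/\ measurable_fun setT g, forall w, 0 <= g w &
     (\int[P]_w (g w)%:E)%E \is a fin_num]) ->
  (\int[P]_w (\sum_(g <- S) g w)%:E = (\sum_(g <- S) mean P g)%:E)%E.
Proof.
elim: S => [|g S IH] H.
  by under eq_integral do rewrite big_nil; rewrite integral0 big_nil.
have [mg g0 fg] := H g (mem_head _ _).
have HS h : h \in S -> _ := fun hS => H h (mem_behead (s := g :: S) hS).
under eq_integral do rewrite big_cons EFinD.
rewrite ge0_integralD //.
- by rewrite IH // big_cons EFinD /mean fineK.
- by move=> w _; rewrite lee_fin.
- exact/measurable_EFinP.
- move=> w _; rewrite lee_fin big_seq sumr_ge0 // => h /HS[_ h0 _]; exact: h0.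
- apply/measurable_EFinP/measurable_big_sum => h /HS[]//.
Qed.

(** For a fixed schedule the stack sizes are fixed, and the cost is a combination of lengths and
    rates with nonnegative, possibly infinite, coefficients. So expectation replaces each length and
    rate by its mean. *)
Lemma integral_cost_from d (T : measurableType d) (R : realType)
    (P : probability T R) (f : nat -> \bar R) (X : seq (T -> R * R)) js
    (S : seq (T -> R)) :
  (forall k, 0 <= f k)%E ->
  (forall x, x \in X -> [/\ measurable_fun setT x,
     forall w, 0 <= (x w).1 /\ 0 <= (x w).2,
     (\int[P]_w (x w).1%:E)%E \is a fin_num &
     (\int[P]_w (x w).2%:E)%E \is a fin_num]) ->
  (forall g, g \in S -> [/\ measurable_fun setT g, forall w, 0 <= g w &
     (\int[P]_w (g w)%:E)%E \is a fin_num]) ->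
  (\int[P]_w cost_from f [seq g w | g <- S] [seq x w | x <- X] js)%E =
  cost_from f [seq mean P g | g <- S]
    [seq (mean P (fst \o x), mean P (snd \o x)) | x <- X] js.
Proof.
move=> f0; elim: X js S => [|x X IH] [|j js] S HX HS; rewrite ?integral0 //.
  under eq_integral do rewrite cost_from_nil.
  by rewrite integral0 cost_from_nil.
have [mx x0 f1 f2] := HX x (mem_head _ _).
have HX' y : y \in X -> _ := fun yX => HX y (mem_behead (s := x :: X) yX).
have HlS g : g \in fst \o x :: S -> [/\ measurable_fun setT g,
    forall w, 0 <= g w & (\int[P]_w (g w)%:E)%E \is a fin_num].
  rewrite inE => /predU1P[->|/HS //]; split => //.
    exact: measurableT_comp.
  by move=> w; case: (x0 w).
have Htake g : g \in take j (fst \o x :: S) -> _ := fun h => HlS g (mem_take h).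
set hd : T -> R := fun w => \sum_(g <- take j (fst \o x :: S)) g w.
have mhd : measurable_fun setT hd.
  by apply: measurable_big_sum => g /Htake[].
have hd0 w : 0 <= hd w.
  by rewrite /hd big_seq sumr_ge0 // => g /Htake[_ g0 _]; exact: g0.
have Ehd : (\int[P]_w (hd w)%:E)%E = (\sum_(g <- take j (fst \o x :: S)) mean P g)%:E.
  exact: integral_sum_take.
have HC g : g \in compact_fun (fst \o x) j S -> [/\ measurable_fun setT g,
    forall w, 0 <= g w & (\int[P]_w (g w)%:E)%E \is a fin_num].
  rewrite inE => /predU1P[->|/mem_drop/HlS//].
  by split => //; rewrite [X in X \is a fin_num]Ehd.
under eq_integral do rewrite cost_from_fun_cons.
have mX y : y \in X -> measurable_fun setT y by move=> /HX'[].
have mC : measurable_fun setT (fun w => cost_from f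
    [seq g w | g <- compact_fun (fst \o x) j S] [seq y w | y <- X] js).
  by apply: measurable_cost_from => // g /HC[].
have C0 w : (0 <= cost_from f
    [seq g w | g <- compact_fun (fst \o x) j S] [seq y w | y <- X] js)%E.
  apply: cost_from_ge0 => //; apply/allP => _ /mapP[y yin ->].
    by have [_ y0 _ _] := HX' _ yin; case: (y0 w) => -> ->.
  by have [_ -> _] := HC _ yin.
have mr : measurable_fun setT (snd \o x) by exact: measurableT_comp.
have r0 w : 0 <= (snd \o x) w by case: (x0 w).
rewrite ge0_integralD //; last 2 first.
- move=> w _; apply: adde_ge0; first by rewrite lee_fin; exact: hd0.
  exact: (read_cost_ge0 _ f0 (r0 w)).
- apply: emeasurable_funD; first exact/measurable_EFinP.
  exact: (measurable_read_cost _ _ mr).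
rewrite ge0_integralD //; last 4 first.
- by move=> w _; rewrite lee_fin; exact: hd0.
- exact/measurable_EFinP.
- by move=> w _; exact: (read_cost_ge0 _ f0 (r0 w)).
- exact: (measurable_read_cost _ _ mr).
rewrite IH // map_cons cost_from_cons /=.
rewrite (integral_read_cost _ f0 mr r0 f2) Ehd.
have E : [seq mean P g | g <- compact_fun (fst \o x) j S] =
    Defs.compact (mean P (fst \o x)) j [seq mean P g | g <- S].
  rewrite /Defs.compact -[mean P (fst \o x) :: _]/(map (mean P) (fst \o x :: S)).
  by rewrite -map_take -map_drop big_map /= /mean [X in fine X]Ehd.
rewrite -E.
congr (_%:E + _ + _)%E.
- rewrite -[mean P (fst \o x) :: _]/(map (mean P) (fst \o x :: S)).
  by rewrite -map_take big_map.
- by rewrite !size_drop /= size_map.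
Qed.

(** The index type in [OPT] depends on the input; naming its size [n] gives all sample points the
    same finite set of schedules. *)
Lemma OPT_sizeE (R : realType) (f : nat -> \bar R) I n : size I = n ->
  OPT f I = \big[Order.min/+oo%E]_(js : n.-tuple 'I_n.+1
     | is_schedule 0 [seq val j | j <- js]) cost f I [seq val j | j <- js].
Proof. by move=> <-. Qed.

Lemma OPT_le_cost (R : realType) (f : nat -> \bar R) I js :
  is_schedule 0 js -> size js = size I -> (OPT f I <= cost f I js)%E.
Proof.
move=> V sz; have /allP B := size_valid_le V.
pose t := map_tuple (fun j => inord j : 'I_(size js).+1) (in_tuple js).
have tE : [seq val j | j <- t] = js.
  rewrite -map_comp map_id_in // => j /B; rewrite add0n => jn.
  by rewrite /= inordK // ltnS.
rewrite (OPT_sizeE _ (esym sz)) -[X in (_ <= cost _ _ X)%E]tE.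
pose F (u : (size js).-tuple 'I_(size js).+1) := cost f I [seq val j | j <- u].
by apply: (@bigmin_le_cond _ _ _ +oo%E t _ F); rewrite tE.
Qed.

Lemma OPT_ge (R : realType) (f : nat -> \bar R) I x :
  (forall js, is_schedule 0 js -> size js = size I -> (x <= cost f I js)%E) ->
  (x <= OPT f I)%E.
Proof.
move=> H; rewrite /OPT; apply: le_bigmin => [|js V]; first by rewrite leey.
by apply: H => //; rewrite size_map size_tuple.
Qed.

Lemma measurable_OPT d (T : measurableType d) (R : realType)
    (f : nat -> \bar R) (X : seq (T -> R * R)) :
  (forall x, x \in X -> measurable_fun setT x) ->
  measurable_fun setT (fun w => OPT f [seq x w | x <- X]).
Proof.
move=> mX; under eq_fun do rewrite (OPT_sizeE _ (size_map _ _)).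
elim: (index_enum _) => [|js s IH].
  rewrite (_ : (fun _ => _) = cst +oo%E); first exact: measurable_cst.
  by apply/funext => w; rewrite big_nil.
under eq_fun do rewrite big_cons.
case: (is_schedule _ _) => //; apply: measurable_mine => //.
exact: (@measurable_cost_from _ _ _ f X _ [::]).
Qed.

(** * Truncation of the samples to a bounded range *)

Definition clip (R : realType) (M : R) (z : R * R) : R * R :=
  (Num.min (Num.max 0 z.1) M, Num.min (Num.max 0 z.2) M).

Lemma clip_itv (R : realType) (M : R) z : 0 <= M ->
  0 <= (clip M z).1 <= M /\ 0 <= (clip M z).2 <= M.
Proof. by move=> M0; rewrite /= !le_min !ge_min !le_max !lexx !M0 !orbT. Qed.

Lemma measurable_clip (R : realType) (M : R) : measurable_fun setT (clip M).
Proof.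
apply/measurable_fun_pairP; split.
- apply: measurable_minr => //; apply: measurable_maxr => //.
- apply: measurable_minr => //; apply: measurable_maxr => //.
Qed.

(** The support conditions hold only almost surely, whereas clipped samples are nonnegative and
    bounded at every sample point; the change does not affect any integral. *)
Lemma bounded_support_clip (R : realType) (p : probability (R * R)%type R) :
  nonneg_bounded_support p ->
  exists2 M : R, 0 <= M & p.-negligible [set z | clip M z <> z].
Proof.
move=> [p0 [M pM]]; exists (Num.max M 0); first by rewrite le_max lexx orbT.
have negC (A : set (R * R)) : measurable A -> p A = 1%E -> p.-negligible (~` A).
  move=> mA pA; apply/negligibleP; first exact: measurableC.
  transitivity (1 - p A)%E; [exact: probability_setC | by rewrite pA subee].
have m1 : measurable_fun setT (fst : R * R -> R) by exact: measurable_fst.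
have m2 : measurable_fun setT (snd : R * R -> R) by exact: measurable_snd.
have A0 : measurable [set x : R * R | 0 <= x.1 /\ 0 <= x.2].
  rewrite (_ : mkset _ = fst @^-1` `[0, +oo[%classic `&` snd @^-1` `[0, +oo[%classic).
    apply: measurableI; rewrite -[X in measurable X]setTI; [exact: m1|exact: m2].
  by apply/seteqP; split => z /=; rewrite !in_itv /= !andbT.
have AM : measurable [set x : R * R | `|x.1| <= M /\ `|x.2| <= M].
  rewrite (_ : mkset _ = fst @^-1` `[- M, M]%classic `&` snd @^-1` `[- M, M]%classic).
    apply: measurableI; rewrite -[X in measurable X]setTI; [exact: m1|exact: m2].
  by apply/seteqP; split => z /=; rewrite !in_itv /= !ler_norml.
apply: negligibleS (negligibleU (negC _ A0 p0) (negC _ AM pM)).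
move=> [x y] /= H; apply: contrapT => /not_orP[/contrapT[/= x0 y0] /contrapT[/= xM yM]].
apply: H; rewrite /clip /=; congr pair.
  by rewrite max_r // min_l // le_max (le_trans _ xM) // ler_norm.
by rewrite max_r // min_l // le_max (le_trans _ yM) // ler_norm.
Qed.

Lemma integral_iid d (Omega : measurableType d) (R : realType)
    (P : probability Omega R) (p : probability (R * R)%type R) n
    (X : 'I_n -> Omega -> R * R) (f : R * R -> \bar R) t :
  iid_sample P p X -> measurable_fun setT f -> (forall z, 0 <= f z)%E ->
  (\int[P]_w f (X t w) = \int[p]_z f z)%E.
Proof.
move=> [mX lawX _] mf f0.
rewrite -(@eq_measure_integral _ _ _ _ p (pushforward P (X t))); last first.
  by move=> A mA _; exact: lawX.
by rewrite ge0_integral_pushforward // preimage_setT.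
Qed.

Lemma integral_clip d (T : measurableType d) (R : realType) (P : probability T R)
    (M : R) (h : R * R -> R) (X : T -> R * R) :
  P.-negligible [set w | clip M (X w) <> X w] -> measurable_fun setT h ->
  measurable_fun setT X ->
  (\int[P]_w (h (clip M (X w)))%:E = \int[P]_w (h (X w))%:E)%E.
Proof.
move=> N mh mX; apply: ae_eq_integral => //.
- apply/measurable_EFinP; apply: measurableT_comp => //.
  by apply: measurableT_comp => //; exact: measurable_clip.
- by apply/measurable_EFinP; apply: measurableT_comp.
- apply: negligibleS N => w /= H E; apply: H => _; by rewrite E.
Qed.

Definition sample (Omega : Type) (R : realType) n (X : 'I_n -> Omega -> R * R) w :
  seq (R * R) := tval [tuple X t w | t < n].

Lemma sampleE (Omega : Type) (R : realType) n (X : 'I_n -> Omega -> R * R) w :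
  sample X w = [seq x w | x <- [seq X t | t <- enum 'I_n]].
Proof. by rewrite -map_comp. Qed.

Lemma clip_sampleE (Omega : Type) (R : realType) (M : R) n
    (X : 'I_n -> Omega -> R * R) w :
  [seq clip M z | z <- sample X w] =
  [seq x w | x <- [seq (fun w => clip M (X t w)) | t <- enum 'I_n]].
Proof. by rewrite sampleE -!map_comp. Qed.

Lemma size_sample (Omega : Type) (R : realType) n (X : 'I_n -> Omega -> R * R) w :
  size (sample X w) = n.
Proof. exact: size_tuple. Qed.

Lemma nth_sample (Omega : Type) (R : realType) n (X : 'I_n -> Omega -> R * R) w
    (t : 'I_n) : nth (0, 0) (sample X w) t = X t w.
Proof. by rewrite -tnth_nth tnth_mktuple. Qed.

Definition clipped (Omega : Type) (R : realType) (M : R) n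
    (X : 'I_n -> Omega -> R * R) w (i : nat) : R * R :=
  clip M (nth (0, 0) (sample X w) i).

Lemma clip_sample_input (Omega : Type) (R : realType) (M : R) n
    (X : 'I_n -> Omega -> R * R) w :
  [seq clip M z | z <- sample X w] =
  input (fun i => (clipped M X w i).1)
        (fun i => (clipped M X w i).2) 0 n.
Proof.
apply: (@eq_from_nth _ (0, 0)); first by rewrite size_map size_sample size_map size_iota.
rewrite size_map size_sample => i i_lt.
rewrite (nth_map (0, 0)) ?size_sample //.
by rewrite [RHS](nth_map 0%N) ?size_iota // nth_iota.
Qed.

Lemma negligible_clip_sample d (Omega : measurableType d) (R : realType)
    (P : probability Omega R) (p : probability (R * R)%type R) (M : R) n
    (X : 'I_n -> Omega -> R * R) :
  p.-negligible [set z | clip M z <> z] -> iid_sample P p X ->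
  P.-negligible [set w | [seq clip M z | z <- sample X w] <> sample X w].
Proof.
move=> [B [mB pB sB]] [mX lawX _].
have : P.-negligible (\big[setU/set0]_(t <- enum 'I_n) (X t @^-1` B)).
  elim: (enum _) => [|t s IH]; first by rewrite big_nil; exact: negligible_set0.
  rewrite big_cons; apply: negligibleU IH; exists (X t @^-1` B); split => //.
    by rewrite -[X in measurable X]setTI; exact: mX.
  by rewrite -pB; exact: lawX.
apply: negligibleS => w /= H; rewrite -bigcup_seq /=.
apply: contrapT => H'; apply: H.
rewrite clip_sampleE sampleE -!map_comp; apply: eq_map => t /=.
apply: contrapT => H; apply: H'; exists t; first by rewrite /= mem_enum.
exact: sB.
Qed.

Lemma measurable_clip_comp d (T : measurableType d) (R : realType) (M : R)
    (X : T -> R * R) :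
  measurable_fun setT X -> measurable_fun setT (fun w => clip M (X w)).
Proof. by move=> mX; apply: (measurableT_comp (measurable_clip M) mX). Qed.

Lemma integral_clip_sample d (Omega : measurableType d) (R : realType)
    (P : probability Omega R) (p : probability (R * R)%type R) (M : R) n
    (X : 'I_n -> Omega -> R * R) (F : seq (R * R) -> \bar R) :
  p.-negligible [set z | clip M z <> z] -> iid_sample P p X ->
  (forall Xs : seq (Omega -> R * R), (forall x, x \in Xs -> measurable_fun setT x) ->
     measurable_fun setT (fun w => F [seq x w | x <- Xs])) ->
  (\int[P]_w F (sample X w) = \int[P]_w F [seq clip M z | z <- sample X w])%E.
Proof.
move=> pM iidX mF; have [mX _ _] := iidX; apply: ae_eq_integral => //.
- by under eq_fun do rewrite sampleE; apply: mF => _ /mapP[t _ ->].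
- under eq_fun do rewrite clip_sampleE; apply: mF => _ /mapP[t _ ->].
  exact: measurable_clip_comp.
- apply: negligibleS (negligible_clip_sample pM iidX) => w /= H E.
  by apply: H; rewrite E.
Qed.

Lemma OPT_clip_ge0 (Omega : Type) (R : realType) (M : R) n
    (X : 'I_n -> Omega -> R * R) (f : nat -> \bar R) w : 0 <= M ->
  (forall k, 0 <= f k)%E -> (0 <= OPT f [seq clip M z | z <- sample X w])%E.
Proof.
move=> M0 f0; apply: OPT_ge => js _ _; rewrite clip_sample_input.
have clip0 i := clip_itv (nth (0, 0) (sample X w) i) M0.
apply: cost_input_ge0 => // i; first by case: (clip0 i) => /andP[].
by case: (clip0 i) => _ /andP[].
Qed.

(** A lower bound that holds for every schedule at every sample point is integrated; each of the [n]
    deficits contributes at most [C]. *)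
Lemma expected_OPT_ge d (Omega : measurableType d) (R : realType)
    (P : probability Omega R) (p : probability (R * R)%type R) (M : R) n
    (X : 'I_n -> Omega -> R * R) (f : nat -> \bar R) (Psi C : R)
    (D : nat -> Omega -> R) :
  0 <= M -> p.-negligible [set z | clip M z <> z] -> iid_sample P p X ->
  (forall k, 0 <= f k)%E -> 0 <= C ->
  (forall s, measurable_fun setT (D s)) -> (forall s w, 0 <= D s w) ->
  (forall s, (s < n)%N -> \int[P]_w (D s w)%:E <= C%:E)%E ->
  (forall w js, is_schedule 0 js -> size js = n ->
    (Psi - \sum_(0 <= s < n) D s w)%:E <=
    cost f (input (fun i => (clipped M X w i).1)
        (fun i => (clipped M X w i).2) 0 n) js)%E ->
  ((Psi - C * n%:R)%:E <= \int[P]_w OPT f (sample X w))%E.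
Proof.
move=> M0 pM iidX f0 C0 mD D0 DC H; have [mX _ _] := iidX.
rewrite (integral_clip_sample pM iidX); last by move=> Xs; exact: measurable_OPT.
have O0 w := OPT_clip_ge0 X w M0 f0.
have mO : measurable_fun setT (fun w => OPT f [seq clip M z | z <- sample X w]).
  under eq_fun do rewrite clip_sampleE; apply: measurable_OPT => _ /mapP[t _ ->].
  exact: measurable_clip_comp.
(* For [Psi] at most 0 the bound is trivial. Otherwise the deficits are moved to the other side, and
   only nonnegative functions are integrated. *)
have [Psi0|Psi0] := leP Psi 0.
  apply: (@le_trans _ _ 0%E); last by apply: integral_ge0.
  by rewrite lee_fin subr_le0 (le_trans Psi0) // mulr_ge0.
have mS : measurable_fun setT (fun w => (\sum_(0 <= s < n) D s w)%:E).
  by apply/measurable_EFinP; apply: measurable_sum.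
have S0 w : (0 <= (\sum_(0 <= s < n) D s w)%:E)%E by rewrite lee_fin sumr_ge0.
have SC : (\int[P]_w (\sum_(0 <= s < n) D s w)%:E <= (C * n%:R)%:E)%E.
  under eq_integral do rewrite -sumEFin.
  rewrite ge0_integral_sum //; last 2 first.
  - by move=> s; exact/measurable_EFinP.
  - by move=> s w _; rewrite lee_fin.
  apply: (@le_trans _ _ (\sum_(0 <= s < n) C%:E)%E).
    rewrite big_seq [leRHS]big_seq; apply: lee_sum => s.
    by rewrite mem_index_iota => /andP[_ sn]; exact: DC.
  by rewrite sumEFin sumr_const_nat subn0 mulr_natr.
rewrite EFinB leeBlDr //; apply: le_trans (leeD (lexx _) SC).
rewrite -ge0_integralD //.
have <- : (\int[P]_w (Psi%:E) = Psi%:E)%E.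
  by rewrite integral_cst //= probability_setT mule1.
apply: ge0_le_integral => //.
- by move=> w _; rewrite lee_fin ltW.
- exact: emeasurable_funD.
- move=> w _; rewrite -leeBlDr // -EFinB; apply: OPT_ge => js V.
  by rewrite size_map size_sample clip_sample_input => sz; exact: H.
Qed.

(** * Deficits of random walks with negative drift *)

Lemma sum_ge_deficit (R : realType) (h g : nat -> R) (theta c : R) a b :
  0 < theta -> (forall i, expR (theta * (c - h i)) <= g i) -> (a <= b)%N ->
  c * (b - a)%N%:R <= \sum_(a <= i < b) h i + theta^-1 * \prod_(a <= i < b) g i.
Proof.
move=> t0 hg ab.
have h1 : \prod_(a <= i < b) expR (theta * (c - h i)) <= \prod_(a <= i < b) g i.
  by apply: ler_prod => i _; rewrite expR_ge0 hg.
(* The inequality 1 + x <= exp x is applied to x = theta times the sum of c - h i. *)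
rewrite -expR_sum in h1; have h2 := le_trans (expR_ge1Dx _) h1.
rewrite -mulr_sumr sumrB sumr_const_nat in h2.
rewrite mulr_natr -lerBlDl ler_pdivlMl //.
by apply: le_trans h2; rewrite lerDr.
Qed.

Lemma sum_geometric_le (R : realType) (rho : R) (n : nat) :
  0 <= rho < 1 -> \sum_(0 <= k < n) rho ^+ k <= (1 - rho)^-1.
Proof.
move=> /andP[r0 r1]; have d0 : 0 < 1 - rho by rewrite subr_gt0.
rewrite -[leRHS]mul1r ler_pdivlMr // mulrC big_mkord.
rewrite -opprB mulNr -subrX1 opprB lerBlDr lerDl exprn_ge0 //.
Qed.

Section Deficits.
Variables (R : realType) (p : probability (R * R)%type R) (h : R * R -> R).
Variables (theta rho : R) (g : R * R -> R).
Hypotheses (theta0 : 0 < theta) (rho01 : 0 <= rho < 1).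
Hypotheses (mg : measurable_fun setT g).
Variables (c : R) (hg : forall z, expR (theta * (c - h z)) <= g z).
Hypothesis (Hrho : forall d (Omega : measurableType d) (P : probability Omega R) n
      (X : 'I_n -> Omega -> R * R) (J : {set 'I_n}), iid_sample P p X ->
      (\int[P]_w (\prod_(i in J) g (X i w))%:E = (rho ^+ #|J|)%:E)%E).
Variables (d : measure_display) (Omega : measurableType d) (P : probability Omega R).
Variables (n : nat) (X : 'I_n -> Omega -> R * R).
Hypothesis (iidX : iid_sample P p X).

Definition gprod a b w : R :=
  \prod_(a <= i < b) g (nth (0, 0) (sample X w) i).

Lemma gprod_ge0 a b w : 0 <= gprod a b w.
Proof. by apply: prodr_ge0 => i _; apply: le_trans (hg _); exact: expR_ge0. Qed.

Lemma measurable_nth_sample i :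
  measurable_fun setT (fun w => nth (0, 0) (sample X w) i).
Proof.
have [mX _ _] := iidX.
have [i_lt|i_ge] := ltnP i n.
  by under eq_fun do rewrite (nth_sample X _ (Ordinal i_lt)); exact: mX.
under eq_fun do rewrite nth_default ?size_sample //; exact: measurable_cst.
Qed.

Lemma measurable_gprod a b : measurable_fun setT (gprod a b).
Proof.
apply: measurable_prod => i _.
by apply: (measurableT_comp mg); exact: measurable_nth_sample.
Qed.

Lemma integral_gprod a b : (a <= b <= n)%N ->
  (\int[P]_w (gprod a b w)%:E = (rho ^+ (b - a))%:E)%E.
Proof.
move=> /andP[ab bn].
(* The interval becomes a subset of the index type of the samples, as [Hrho] requires. *)
have E (F : nat -> R) : \prod_(a <= i < b) F i =
    \prod_(i in [set i : 'I_n | (a <= i < b)%N]%SET) F i.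
  rewrite (big_nat_widenl _ 0) // (big_nat_widen _ _ n) // big_mkord.
  by apply: eq_bigl => i; rewrite inE.
rewrite -prodr_const_nat E prodr_const -(Hrho _ iidX).
apply: eq_integral => w _; rewrite /gprod E; congr EFin.
by apply: eq_bigr => i _; rewrite nth_sample.
Qed.

(** The sum over all starting points dominates each of its terms, so a single deficit at [s] serves
    all intervals ending at [s]. The expected terms form a geometric series in [rho], which bounds
    the expectation uniformly in [s] and [n]. [forth_deficit] does the same for the intervals that
    start at [s] and stay within the input. *)
Definition back_deficit s w : R := theta^-1 * \sum_(0 <= a < s.+1) gprod a s.+1 w.

Definition forth_deficit s w : R := theta^-1 * \sum_(s <= b < n) gprod s b.+1 w.

Lemma deficit_props D : D = back_deficit \/ D = forth_deficit ->
  [/\ forall s, measurable_fun setT (D s), forall s w, 0 <= D s w &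
   forall s, (s < n)%N -> (\int[P]_w (D s w)%:E <= (theta^-1 * (1 - rho)^-1)%:E)%E].
Proof.
have ti0 : 0 <= theta^-1 by rewrite invr_ge0 ltW.
have r0 : 0 <= rho by case/andP: rho01.
have int_le (I : seq nat) (a b : nat -> nat) :
    (forall k, k \in I -> (a k <= b k <= n)%N) ->
    \sum_(k <- I) rho ^+ (b k - a k) <= (1 - rho)^-1 ->
    (\int[P]_w (theta^-1 * \sum_(k <- I) gprod (a k) (b k) w)%:E <=
       (theta^-1 * (1 - rho)^-1)%:E)%E.
  move=> Hab Hle; under eq_integral do rewrite EFinM -sumEFin.
  rewrite ge0_integralZl_EFin //; last 2 first.
  - by move=> w _; apply: sume_ge0 => k _; rewrite lee_fin gprod_ge0.
  - by apply: emeasurable_sum => k; apply/measurable_EFinP; exact: measurable_gprod.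
  rewrite EFinM lee_wpmul2l // ge0_integral_sum //; last 2 first.
  - by move=> k; apply/measurable_EFinP; exact: measurable_gprod.
  - by move=> k w _; rewrite lee_fin gprod_ge0.
  rewrite (eq_big_seq (fun k => (rho ^+ (b k - a k))%:E)).
    by rewrite sumEFin lee_fin.
  by move=> k /Hab; exact: integral_gprod.
have ti (I : seq nat) (a b : nat -> nat) :
    measurable_fun setT (fun w => theta^-1 * \sum_(k <- I) gprod (a k) (b k) w) /\
    forall w, 0 <= theta^-1 * \sum_(k <- I) gprod (a k) (b k) w.
  split=> [|w]; last by rewrite mulr_ge0 // sumr_ge0 // => k _; exact: gprod_ge0.
  apply: measurable_funM => //; apply: measurable_sum => k; exact: measurable_gprod.
case=> ->; split => s.
- by case: (ti (index_iota 0 s.+1) id (fun=> s.+1)).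
- by case: (ti (index_iota 0 s.+1) id (fun=> s.+1)).
- move=> sn; apply: (int_le _ id (fun=> s.+1)) => [k|].
    by rewrite mem_index_iota => /andP[_ ks]; rewrite (ltnW ks).
  apply: le_trans (sum_geometric_le s.+1 rho01).
  (* After reversal the exponents are i + 1; the additional factor [rho] is dropped. *)
  rewrite big_nat_rev /= !big_mkord; apply: ler_sum => i _.
  rewrite add0n subKn; last exact: ltn_ord.
  by rewrite exprS ler_piMl ?exprn_ge0 // ltW //; case/andP: rho01.
- by case: (ti (index_iota s n) (fun=> s) S).
- by case: (ti (index_iota s n) (fun=> s) S).
- move=> sn; apply: (int_le _ (fun=> s) S) => [k|].
    by rewrite mem_index_iota => /andP[sk kn]; rewrite (leq_trans sk) //=.
  apply: le_trans (sum_geometric_le (n - s) rho01).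
  rewrite -{1}[s]add0n big_addn !big_mkord; apply: ler_sum => i _.
  rewrite -addSn addnK.
  by rewrite exprS ler_piMl ?exprn_ge0 // ltW //; case/andP: rho01.
Qed.

Let hY w i := h (nth (0, 0) (sample X w) i).

Lemma sum_ge_back_deficit w a s : (a <= s)%N ->
  c * (s.+1 - a)%N%:R <= \sum_(a <= i < s.+1) hY w i + back_deficit s w.
Proof.
move=> as_; have H := sum_ge_deficit (h := hY w)
  (g := fun i => g (nth (0, 0) (sample X w) i)) theta0 (fun i => hg _) (leqW as_).
apply: (le_trans H).
rewrite lerD2l ler_wpM2l ?invr_ge0 ?(ltW theta0) //.
rewrite [leRHS](bigD1_seq a) ?iota_uniq ?mem_index_iota //= lerDl sumr_ge0 // => k _.
exact: gprod_ge0.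
Qed.

Lemma sum_ge_forth_deficit w s b : (s <= b < n)%N ->
  c * (b.+1 - s)%N%:R <= \sum_(s <= i < b.+1) hY w i + forth_deficit s w.
Proof.
move=> /andP[sb bn].
have H := sum_ge_deficit (h := hY w)
  (g := fun i => g (nth (0, 0) (sample X w) i)) theta0 (fun i => hg _) (leqW sb).
apply: (le_trans H).
rewrite lerD2l ler_wpM2l ?invr_ge0 ?(ltW theta0) //.
rewrite [leRHS](bigD1_seq b) ?iota_uniq ?mem_index_iota ?sb //= lerDl sumr_ge0 // => k _.
exact: gprod_ge0.
Qed.

End Deficits.

(** * Expected optimum and expected cost of tree algorithms *)

Lemma integral_clip_fst (R : realType) (p : probability (R * R)%type R) (M l : R) :
  p.-negligible [set z | clip M z <> z] -> 'E_p[fst]%E = l%:E ->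
  (\int[p]_z (clip M z).1%:E)%E = l%:E.
Proof.
by move=> pM <-; rewrite unlock; apply: (@integral_clip _ _ _ _ M fst id).
Qed.

Lemma integral_clip_snd (R : realType) (p : probability (R * R)%type R) (M r : R) :
  p.-negligible [set z | clip M z <> z] -> 'E_p[snd]%E = r%:E ->
  (\int[p]_z (clip M z).2%:E)%E = r%:E.
Proof.
by move=> pM <-; rewrite unlock; apply: (@integral_clip _ _ _ _ M snd id).
Qed.

Lemma measurable_clip_fst (R : realType) (M : R) :
  measurable_fun setT (fun z : R * R => (clip M z).1).
Proof. exact: (measurableT_comp measurable_fst (measurable_clip M)). Qed.

Lemma measurable_clip_snd (R : realType) (M : R) :
  measurable_fun setT (fun z : R * R => (clip M z).2).
Proof. exact: (measurableT_comp measurable_snd (measurable_clip M)). Qed.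

(** The constant [C] comes from the exponential moment for [c] alone, so it is fixed before [n], [K]
    and [m], and [m] may be optimized for each [n]. *)
Lemma expected_OPT_atmost_ge (R : realType) (p : probability (R * R)%type R) (l c : R) :
  nonneg_bounded_support p -> 'E_p[fst]%E = l%:E -> 0 <= c < l ->
  exists2 C : R, 0 <= C &
    forall d (Omega : measurableType d) (P : probability Omega R) n
      (X : 'I_n -> Omega -> R * R) K m, iid_sample P p X ->
    ((c * (m%:R * n.+1%:R - 'C(m + K, K.+1)%:R) - C * n%:R)%:E <=
     \int[P]_w OPT (f_atmost R K) (sample X w))%E.
Proof.
move=> suppp El /andP[c0 cl]; have [M M0 pM] := bounded_support_clip suppp.
have h01 (z : R * R) : 0 <= (clip M z).1 <= M by case: (clip_itv z M0).
have [theta [rho [g [t0 r01 mg hg Hrho]]]] :=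
  exponential_moment (measurable_clip_fst M) h01 (integral_clip_fst pM El) cl.
exists (theta^-1 * (1 - rho)^-1).
  by case/andP: r01 => _ r1; rewrite mulr_ge0 // invr_ge0 ?subr_ge0 ltW.
move=> d Omega P n X K m iidX.
have [mD D0 DC] := deficit_props t0 r01 mg hg Hrho iidX (or_introl erefl).
apply: (expected_OPT_ge M0 pM iidX _ _ mD D0 DC).
- exact: f_atmost_ge0.
- by case/andP: r01 => _ r1; rewrite mulr_ge0 // invr_ge0 ?subr_ge0 ltW.
move=> w js V sz.
apply: (@cost_atmost_ge R _ _ (fun s => back_deficit theta g X s w) c K 0 n m js) => //.
- by move=> i; case: (clip_itv (nth (0, 0) (sample X w) i) M0) => /andP[].
- by move=> i; case: (clip_itv (nth (0, 0) (sample X w) i) M0) => _ /andP[].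
- by move=> a s as_; apply: (sum_ge_back_deficit t0 hg X w as_).
Qed.

Lemma expected_OPT_linear_ge (R : realType) (p : probability (R * R)%type R)
    (l r c c' : R) :
  nonneg_bounded_support p -> 'E_p[fst]%E = l%:E -> 'E_p[snd]%E = r%:E ->
  c < l -> c' < r ->
  exists2 C : R, 0 <= C &
    forall d (Omega : measurableType d) (P : probability Omega R) n
      (X : 'I_n -> Omega -> R * R) (Phi : nat -> R), iid_sample P p X ->
    Phi 0%N <= 0 ->
    (forall i j, Phi (i + j).+1 <= c * i.+1%:R + c' * j.+1%:R + Phi i + Phi j) ->
    ((Phi n - C * n%:R)%:E <= \int[P]_w OPT (@f_linear R) (sample X w))%E.
Proof.
move=> suppp El Er cl cr; have [M M0 pM] := bounded_support_clip suppp.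
have h01 (z : R * R) : 0 <= (clip M z).1 <= M by case: (clip_itv z M0).
have h02 (z : R * R) : 0 <= (clip M z).2 <= M by case: (clip_itv z M0).
have [theta [rho [g [t0 r01 mg hg Hrho]]]] :=
  exponential_moment (measurable_clip_fst M) h01 (integral_clip_fst pM El) cl.
have [theta' [rho' [g' [t0' r01' mg' hg' Hrho']]]] :=
  exponential_moment (measurable_clip_snd M) h02 (integral_clip_snd pM Er) cr.
have C0 (t q : R) : 0 < t -> 0 <= q < 1 -> 0 <= t^-1 * (1 - q)^-1.
  by move=> ht /andP[_ q1]; rewrite mulr_ge0 // invr_ge0 ?subr_ge0 ltW.
exists (theta^-1 * (1 - rho)^-1 + theta'^-1 * (1 - rho')^-1).
  by rewrite addr_ge0 ?C0.
move=> d Omega P n X Phi iidX P0 PS.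
have [mD D0 DC] := deficit_props t0 r01 mg hg Hrho iidX (or_introl erefl).
have [mD' D0' DC'] := deficit_props t0' r01' mg' hg' Hrho' iidX (or_intror erefl).
apply: (expected_OPT_ge (D := fun s w => back_deficit theta g X s w +
   forth_deficit theta' g' X s w) M0 pM iidX).
- exact: f_linear_ge0.
- by rewrite addr_ge0 ?C0.
- by move=> s; exact: measurable_funD.
- by move=> s w; rewrite addr_ge0.
- move=> s sn; under eq_integral do rewrite EFinD.
  rewrite ge0_integralD //.
  + by rewrite EFinD leeD ?DC ?DC'.
  + by move=> w _; rewrite lee_fin.
  + exact/measurable_EFinP.
  + by move=> w _; rewrite lee_fin.
  + exact/measurable_EFinP.
move=> w js V sz.
apply: (@cost_linear_ge R _ _ (fun s => back_deficit theta g X s w)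
  (fun s => forth_deficit theta' g' X s w) c c' Phi n 0 n js) => //.
- by move=> a s as_; apply: (sum_ge_back_deficit t0 hg X w as_).
- by move=> s b sb; apply: (sum_ge_forth_deficit t0' hg' X w sb).
Qed.

(** The schedule does not look at the data, so expectation turns its cost into the cost for the
    constant input of means. *)
Lemma expected_tree_algorithm (R : realType) (p : probability (R * R)%type R)
    (l r : R) d (Omega : measurableType d) (P : probability Omega R) n
    (X : 'I_n -> Omega -> R * R) (f : nat -> \bar R) b m :
  nonneg_bounded_support p -> 'E_p[fst]%E = l%:E -> 'E_p[snd]%E = r%:E ->
  iid_sample P p X -> (forall k, 0 <= f k)%E ->
  (n <= tsize (left_nested b m))%N ->
  (\int[P]_w alg_cost f (tree_algorithm R b) (sample X w))%E =
  uniform_cost f l r (prefix_tree (left_nested b m) n).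
Proof.
move=> suppp El Er iidX f0 nm; have [M M0 pM] := bounded_support_clip suppp.
have [mX _ _] := iidX.
pose js := tree_schedule (prefix_tree (left_nested b m) n).
transitivity (\int[P]_w cost f (sample X w) js)%E.
  apply: eq_integral => w _; rewrite /alg_cost /=.
  have szS := size_sample X w; have nm' := nm; rewrite -szS in nm'.
  by rewrite (schedule_of_left_nested nm') szS.
rewrite (integral_clip_sample pM iidX (F := fun I => cost f I js)); last first.
  by move=> Xs mXs; apply: (@measurable_cost_from _ _ _ f Xs js [::]).
under eq_integral do rewrite clip_sampleE.
have I1 t : (\int[P]_w (clip M (X t w)).1%:E)%E = l%:E.
  rewrite -(integral_clip_fst pM El).
  apply: (integral_iid (f := fun z => (clip M z).1%:E) t iidX).
    by apply/measurable_EFinP; exact: measurable_clip_fst.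
  by move=> z; rewrite lee_fin; case: (clip_itv z M0) => /andP[].
have I2 t : (\int[P]_w (clip M (X t w)).2%:E)%E = r%:E.
  rewrite -(integral_clip_snd pM Er).
  apply: (integral_iid (f := fun z => (clip M z).2%:E) t iidX).
    by apply/measurable_EFinP; exact: measurable_clip_snd.
  by move=> z; rewrite lee_fin; case: (clip_itv z M0) => _ /andP[].
rewrite (@integral_cost_from _ _ _ P f _ js [::]) //; last first.
  move=> _ /mapP[t _ ->]; split.
  - exact: measurable_clip_comp.
  - by move=> w; case: (clip_itv (X t w) M0) => /andP[-> _] /andP[-> _].
  - by rewrite [X in X \is a fin_num]I1.
  - by rewrite [X in X \is a fin_num]I2.
rewrite /uniform_cost /cost tsize_prefix // -/js; congr cost_from.
rewrite -map_comp (eq_map (g := fun=> (l, r))).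
  by rewrite -[X in nseq X _](card_ord n) cardE; elim: (enum _) => //= t s ->.
by move=> t /=; rewrite /mean [X in fine X]I1 [X in (_, fine X)]I2.
Qed.

Lemma expected_OPT_ge0 (R : realType) (p : probability (R * R)%type R)
    d (Omega : measurableType d) (P : probability Omega R) n
    (X : 'I_n -> Omega -> R * R) (f : nat -> \bar R) :
  nonneg_bounded_support p -> iid_sample P p X -> (forall k, 0 <= f k)%E ->
  (0 <= \int[P]_w OPT f (sample X w))%E.
Proof.
move=> suppp iidX f0; have [M M0 pM] := bounded_support_clip suppp.
rewrite (integral_clip_sample pM iidX (F := OPT f)); last first.
  by move=> Xs; exact: measurable_OPT.
by apply: integral_ge0 => w _; exact: OPT_clip_ge0.
Qed.

Lemma expected_OPT_le_tree (R : realType) (p : probability (R * R)%type R)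
    d (Omega : measurableType d) (P : probability Omega R) n
    (X : 'I_n -> Omega -> R * R) (f : nat -> \bar R) b :
  nonneg_bounded_support p -> iid_sample P p X -> (forall k, 0 <= f k)%E ->
  (\int[P]_w OPT f (sample X w) <=
   \int[P]_w alg_cost f (tree_algorithm R b) (sample X w))%E.
Proof.
move=> suppp iidX f0; have [M M0 pM] := bounded_support_clip suppp.
have [mX _ _] := iidX.
pose js := tree_schedule (prefix_tree (left_nested b n) n).
have nm := leq_tsize_left_nested b n.
rewrite (_ : (\int[P]_w alg_cost _ _ _)%E = (\int[P]_w cost f (sample X w) js)%E); last first.
  apply: eq_integral => w _; rewrite /alg_cost /=.
  have szS := size_sample X w; have nm' := nm; rewrite -{1}szS in nm'.
  by rewrite (schedule_of_left_nested nm') szS.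
have mc (Xs : seq (Omega -> R * R)) : (forall x, x \in Xs -> measurable_fun setT x) ->
    measurable_fun setT (fun w => cost f [seq x w | x <- Xs] js).
  by move=> mXs; apply: (@measurable_cost_from _ _ _ f Xs js [::]).
rewrite (integral_clip_sample pM iidX (F := fun I => cost f I js) mc).
rewrite (integral_clip_sample pM iidX (F := OPT f)); last first.
  by move=> Xs; exact: measurable_OPT.
have mXc : forall x, x \in [seq (fun w => clip M (X t w)) | t <- enum 'I_n] ->
    measurable_fun setT x.
  by move=> _ /mapP[t _ ->]; exact: measurable_clip_comp.
apply: ge0_le_integral => //.
- by move=> w _; exact: OPT_clip_ge0.
- by under eq_fun do rewrite clip_sampleE; apply: measurable_OPT.
- by under eq_fun do rewrite clip_sampleE; exact: mc.
- move=> w _; apply: OPT_le_cost.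
    by case: (tree_schedule_valid (prefix_tree (left_nested b n) n) 0).
  by rewrite size_tree_schedule tsize_prefix // size_map size_sample.
Qed.

(** * The cost with stack size at most K *)

(** Both expectations lie between (1 - eps) g - C' n and g + C n, where C' may depend on eps; since
    n is o(g), the linear terms vanish in the limit. *)
Lemma asymp_equiv_of_bounds (R : realType) (EA EOPT : nat -> \bar R) (g : nat -> R) C :
  (forall n, 0 <= EOPT n)%E -> (forall n, EOPT n <= EA n)%E ->
  (forall n, EA n <= (g n + C * n%:R)%:E)%E ->
  (forall eps, 0 < eps < 1 -> exists C', forall n,
     (((1 - eps) * g n - C' * n%:R)%:E <= EOPT n)%E) ->
  (forall e, 0 < e -> \forall n \near \oo, n%:R <= e * g n) ->
  asymp_equiv EA EOPT /\ asymp_equiv EOPT (fun n => (g n)%:E).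
Proof.
move=> O0 OA AC OC' small.
have small' a e : 0 < e -> \forall n \near \oo, a * n%:R <= e * g n.
  move=> e0; have a0 : 0 < `|a| + 1 by rewrite ltr_wpDl.
  have := small (e / (`|a| + 1)) (divr_gt0 e0 a0).
  apply: filterS => n; rewrite -ler_pdivrMl ?divr_gt0 // invf_div mulrAC.
  rewrite ler_pdivrMr // mulrC [g n * _]mulrC; apply: le_trans.
  by rewrite [leRHS]mulrC ler_wpM2r // (le_trans (ler_norm a)) // lerDl.
have opt_fin n : EOPT n = (fine (EOPT n))%:E.
  rewrite fineK // ge0_fin_numE //.
  by rewrite (le_lt_trans (OA n)) // (le_lt_trans (AC n)) // ltry.
split=> e e0.
- pose eps := Num.min e 1 / 4.
  have eps01 : 0 < eps < 1.
    by rewrite /eps; case: (leP e 1) => ?; apply/andP; split; lra.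
  have epse : eps <= e / 4 /\ e * eps <= e / 4.
    by rewrite /eps; case: (leP e 1) => ?; split; nra.
  have [C' HC'] := OC' eps eps01.
  have e2 : 0 < e / 2 by lra.
  have := small' (C + (1 + e) * C') (e / 2) e2; apply: filterS2 (small' 0 1 ltr01) => n g0 Hn.
  have {g0} : 0 <= g n by move: g0; rewrite mul0r mul1r.
  have := O0 n; have := OA n; have := AC n; have := HC' n; rewrite (opt_fin n).
  move: (fine _) => o; case: (EA n) => [a| |] //; rewrite !lee_fin => h1 h2 h3 h4 g0.
  apply/andP; split; first by nra.
  apply: (le_trans h2).
  have : (1 + e) * ((1 - eps) * g n - C' * n%:R) <= (1 + e) * o.
    by rewrite ler_wpM2l //; lra.
  apply: le_trans.
  have [E1 E2] := epse.
  have : (1 + e / 2) * g n <= (1 + e) * (1 - eps) * g n by rewrite ler_wpM2r //; lra.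
  lra.
- pose eps := Num.min e 1 / 4.
  have eps01 : 0 < eps < 1.
    by rewrite /eps; case: (leP e 1) => ?; apply/andP; split; lra.
  have epse : eps <= e / 4 by rewrite /eps; case: (leP e 1) => ?; lra.
  have [C' HC'] := OC' eps eps01.
  have e2 : 0 < e / 2 by lra.
  apply: filterS3 (small' 0 1 ltr01) (small' C e e0) (small' C' (e / 2) e2) => n.
  rewrite mul0r mul1r => g0 h1 h2; apply/andP; split.
    rewrite -EFinM; apply: le_trans (HC' n); rewrite lee_fin; nra.
  rewrite -EFinM; apply: le_trans (OA n) (le_trans (AC n) _); rewrite lee_fin; lra.
Qed.

Lemma ffact_le_expn n k : (n ^_ k <= n ^ k)%N.
Proof.
elim: k n => [|k IH] n; first by rewrite ffactn0 expn0.
rewrite ffactnS expnS leq_mul2l (leq_trans (IH _)) ?orbT //.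
by case: k {IH} => // k; rewrite leq_exp2r // leq_pred.
Qed.

Lemma expn_le_ffact m k : (m ^ k.+1 <= (m + k) ^_ k.+1)%N.
Proof.
elim: k => [|k IH]; first by rewrite addn0 ffactn1 expn1.
by rewrite expnS addnS ffactSS leq_mul // -addnS leq_addr.
Qed.

Lemma bin_le_expn (R : realType) n k : 'C(n, k)%:R <= n%:R ^+ k / k`!%:R :> R.
Proof.
rewrite ler_pdivlMr ?ltr0n ?fact_gt0 // -natrM -natrX ler_nat bin_ffact.
exact: ffact_le_expn.
Qed.

Lemma expn_le_bin (R : realType) m k :
  m%:R ^+ k.+1 / k.+1`!%:R <= 'C(m + k, k.+1)%:R :> R.
Proof.
rewrite ler_pdivrMr ?ltr0n ?fact_gt0 // -natrM -natrX ler_nat bin_ffact.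
exact: expn_le_ffact.
Qed.

(** Induction: the hypothesis times y is added to (x - y)(x^(k+1) - y^(k+1)) >= 0. *)
Lemma young_power (R : realType) (x y : R) k : 0 <= x -> 0 <= y ->
  k.+1%:R * x * y ^+ k <= k%:R * y ^+ k.+1 + x ^+ k.+1.
Proof.
move=> x0 y0; elim: k => [|k IH]; first by rewrite !expr0 !expr1; lra.
have h : y * (k.+1%:R * x * y ^+ k) <= y * (k%:R * y ^+ k.+1 + x ^+ k.+1).
  by rewrite ler_wpM2l.
have : 0 <= (x - y) * (x ^+ k.+1 - y ^+ k.+1).
  have [xy|yx] := leP y x.
    by rewrite mulr_ge0 // subr_ge0 // lerXn2r.
  by rewrite mulr_le0 // subr_le0 ?lerXn2r // ltW.
rewrite -(natr1 k.+1) -(natr1 k) in h *.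
move: h; rewrite (exprS x k.+1) (exprS y k.+1) (exprS y k); lra.
Qed.

Section AtMost.
Variables (R : realType) (K : nat).

(* The K-th root of K! n, to which the optimal recursion depth is asymptotic. *)
Definition depth (n : nat) : R := (K.+1`!%:R * n%:R) `^ K.+1%:R^-1.

Lemma depth_ge0 n : 0 <= depth n. Proof. exact: powR_ge0. Qed.

Lemma depth_expn n : depth n ^+ K.+1 = K.+1`!%:R * n%:R.
Proof.
by rewrite -powR_mulrn ?depth_ge0 // -powRrM mulVf ?pnatr_eq0 // powRr1.
Qed.

Lemma atmost_rateE l n :
  l * K.+1%:R * n%:R `^ (1 + K.+1%:R^-1) / c_ R K.+1 =
  l * (K.+1%:R / K.+2%:R * depth n * n%:R).
Proof.
have i0 : K.+1%:R^-1 != 0 :> R by rewrite invr_eq0 pnatr_eq0.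
rewrite /depth powRM // /c_ invf_div.
have -> : n%:R `^ (1 + K.+1%:R^-1) = n%:R * n%:R `^ K.+1%:R^-1 :> R.
  (* The exponent can be split only for a nonzero base; for n = 0 both sides vanish. *)
  case: n => [|n]; first by rewrite mul0r powR0 // gt_eqF // ltr_pwDl.
  by rewrite powRD ?powRr1 // pnatr_eq0 implybT.
by field; rewrite -natrD pnatr_eq0.
Qed.

Lemma fact_ratio : K.+1`!%:R / K.+2`!%:R = K.+2%:R^-1 :> R.
Proof.
rewrite (factS K.+1) natrM invfM mulrCA mulfV ?mulr1 //.
Qed.

(** As a function of real m >= 0 the left side is largest at [depth n], where equality holds;
    [young_power] replaces the derivative. *)
Lemma depth_upper (m : R) n : 0 <= m ->
  m * n%:R - m ^+ K.+2 / K.+2`!%:R <= K.+1%:R / K.+2%:R * depth n * n%:R.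
Proof.
move=> m0; have := young_power K.+1 m0 (depth_ge0 n).
rewrite (exprS (depth n) K.+1) !depth_expn => h.
have f1 : 0 < K.+1`!%:R :> R by rewrite ltr0n fact_gt0.
have k2 : 0 < K.+2%:R :> R by rewrite ltr0n.
rewrite (factS K.+1) natrM -(ler_pM2l k2) -(ler_pM2l f1) mulrBr mulrBr.
have -> : K.+1`!%:R * (K.+2%:R * (m ^+ K.+2 / (K.+2%:R * K.+1`!%:R))) = m ^+ K.+2.
  by field; rewrite -natrD !pnatr_eq0 -?lt0n ?fact_gt0.
have -> : K.+1`!%:R * (K.+2%:R * (K.+1%:R / K.+2%:R * depth n * n%:R)) =
   K.+1%:R * (depth n * (K.+1`!%:R * n%:R)).
  by field; rewrite -natrD !pnatr_eq0 -?lt0n ?fact_gt0.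
by move: h; set a := m ^+ _; set b := depth n; lra.
Qed.

Lemma depth_lower n :
  exists m : nat, K.+1%:R / K.+2%:R * depth n * n%:R - K.+2%:R * n%:R <=
    m%:R * n.+1%:R - 'C(m + K.+1, K.+2)%:R.
Proof.
have d0 := depth_ge0 n.
pose N := Num.trunc (depth n); have /andP[N1 N2] := truncn_itv d0.
(* This [m] is within K + 2 of the maximizer, and m + K + 1 is at most [depth n] unless the
   truncated difference is 0, in which case the binomial vanishes. So the binomial is at most
   depth^(K+2) / (K+2)! = depth n / (K + 2). *)
exists (N - K.+1)%N.
have mN : depth n - K.+2%:R <= (N - K.+1)%N%:R.
  have : N.+1%:R <= (N - K.+1)%N%:R + K.+2%:R :> R.
    by rewrite -natrD ler_nat; clear; lia.
  by rewrite -/N in N2; lra.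
have CN : 'C(N - K.+1 + K.+1, K.+2)%:R <= depth n * n%:R / K.+2%:R.
  have [NK|KN] := leqP K.+1 N; last first.
    rewrite (_ : (N - K.+1 = 0)%N) ?bin_small // ?mulr_ge0 ?invr_ge0 //.
    by apply/eqP; rewrite subn_eq0 ltnW.
  rewrite subnK //; apply: (le_trans (bin_le_expn _ _ _)).
  apply: (@le_trans _ _ (depth n ^+ K.+2 / K.+2`!%:R)).
    by rewrite ler_wpM2r ?invr_ge0 // lerXn2r ?nnegrE.
  rewrite exprS depth_expn -!mulrA ler_wpM2l // -fact_ratio.
  by rewrite mulrCA.
have h : (depth n - K.+2%:R) * n%:R <= (N - K.+1)%N%:R * n.+1%:R.
  apply: (@le_trans _ _ ((N - K.+1)%N%:R * n%:R)); first by rewrite ler_wpM2r.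
  by rewrite ler_wpM2l // ler_nat.
have -> : K.+1%:R / K.+2%:R * depth n * n%:R =
    depth n * n%:R - depth n * n%:R / K.+2%:R.
  have E : K.+1%:R = K.+2%:R - 1 :> R by rewrite -(natr1 K.+1) addrK.
  by rewrite E mulrBl divff ?pnatr_eq0 // mul1r -mulrA mulrBl mul1r [_^-1 * _]mulrC.
by apply: le_trans (lerB h CN); rewrite mulrBl addrAC.
Qed.

Lemma depth_large (B : R) : \forall n \near \oo, B <= depth n.
Proof.
apply: filterS (nbhs_infty_ger (`|B| ^+ K.+1)) => n Bn.
apply: (le_trans (ler_norm B)); rewrite -(@ler_pXn2r _ K.+1) ?nnegrE ?depth_ge0 //.
rewrite depth_expn (le_trans Bn) // ler_peMl // ler1n fact_gt0 //.
Qed.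

End AtMost.

Lemma exists_level (T : nat -> tree) n : (forall m, (m <= tsize (T m))%N) ->
  tsize (T 0%N) = 0%N -> (0 < n)%N ->
  exists m, (tsize (T m) < n <= tsize (T m.+1))%N.
Proof.
move=> Tm T0 n0; have ex : exists m, (n <= tsize (T m))%N by exists n.
case: (ex_minnP ex) => -[|m] nm minm.
  by move: nm; rewrite T0 leqNgt n0.
exists m; rewrite nm andbT ltnNge; apply/negP => /minm.
by rewrite ltnn.
Qed.

(** The level is the one at which the trees first reach [n] nodes. Replacing its index m + 1 by m
    costs l n, and the rest is at most the maximum in [depth_upper]. *)
Lemma uniform_cost_binomial_rate (R : realType) (l r : R) K n : 0 <= l -> exists2 m,
  (n <= tsize (binomial_tree K.+1 m))%N &
  (uniform_cost (f_atmost R K.+1) l r (prefix_tree (binomial_tree K.+1 m) n)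
    <= (l * (K.+1%:R / K.+2%:R * depth R K n * n%:R) + l * n%:R)%:E)%E.
Proof.
move=> l0; case: (posnP n) => [->|n0].
  by exists 0%N => //; rewrite lee_fin !mulr0 addr0.
have [m nm] := @exists_level (binomial_tree K.+1) n
  (leq_tsize_left_nested _) erefl n0.
exists m.+1; first by case/andP: nm.
apply: (le_trans (uniform_cost_binomial_prefix_le r l0 nm)).
rewrite lee_fin -mulrDr ler_wpM2l //.
have h1 := depth_upper K n (ler0n R m).
have h2 := expn_le_bin R m K.+1.
rewrite -(natr1 m) mulrDl mul1r addrAC lerD2r.
by apply: le_trans h1; rewrite lerD2l lerN2.
Qed.

Lemma expected_cost_atmost_asymp (R : realType) (p : probability (R * R)%type R) (l r : R) K :
  nonneg_bounded_support p -> 'E_p[fst]%E = l%:E -> 'E_p[snd]%E = r%:E ->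
  0 < l ->
  exists A : online_algorithm R, expected_cost_asymp p (f_atmost R K.+1) A
    (fun n => l * K.+1%:R * n%:R `^ (1 + K.+1%:R^-1) / c_ R K.+1).
Proof.
move=> suppp El Er l0.
exists (tree_algorithm R (fun i => binomial_tree K i.+1)).
move=> d Omega P X iidX /=.
have l0' := ltW l0.
have [bE tE] : asymp_equiv (fun n => \int[P n]_w alg_cost (f_atmost R K.+1)
      (tree_algorithm R (fun i => binomial_tree K i.+1)) (sample (X n) w))%E
    (fun n => \int[P n]_w OPT (f_atmost R K.+1) (sample (X n) w))%E /\
  asymp_equiv (fun n => \int[P n]_w OPT (f_atmost R K.+1) (sample (X n) w))%E
    (fun n => (l * (K.+1%:R / K.+2%:R * depth R K n * n%:R))%:E).
  apply: (asymp_equiv_of_bounds (C := l)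
    (g := fun n => l * (K.+1%:R / K.+2%:R * depth R K n * n%:R))).
  - move=> n; apply: (expected_OPT_ge0 suppp (iidX n)); exact: f_atmost_ge0.
  - move=> n; apply: (expected_OPT_le_tree _ suppp (iidX n)).
    exact: f_atmost_ge0.
  - move=> n; have [m nm Hm] := uniform_cost_binomial_rate r K n l0'.
    rewrite (expected_tree_algorithm (m := m) suppp El Er (iidX n)) //.
    exact: f_atmost_ge0.
  - move=> eps eps01; have c0l : 0 <= (1 - eps) * l < l by nra.
    have [C C0 H] := expected_OPT_atmost_ge suppp El c0l.
    exists ((1 - eps) * l * K.+2%:R + C) => n.
    have [m Hm] := depth_lower R K n.
    apply: le_trans (H _ _ _ n _ K.+1 m (iidX n)); rewrite lee_fin.
    rewrite [(_ + C) * _]mulrDl opprD addrA lerD2r.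
    case/andP: c0l => c0 _; apply: le_trans (ler_wpM2l c0 Hm).
    by rewrite mulrBr -!mulrA.
  - move=> e e0.
    have k0 : 0 < e * l * (K.+1%:R / K.+2%:R) by rewrite !mulr_gt0 // invr_gt0.
    apply: filterS (depth_large K (e * l * (K.+1%:R / K.+2%:R))^-1) => n Hn.
    rewrite -[leLHS]mul1r !mulrA ler_wpM2r // -!mulrA.
    by move: Hn; rewrite -[_^-1]mul1r ler_pdivrMr // mulrC -!mulrA [e * _]mulrCA.
split=> //; move=> e e0; have := tE e e0; apply: filterS => n.
by rewrite atmost_rateE.
Qed.

(** * The linear cost *)

Lemma ln_le_sub1 (R : realType) (x : R) : 0 < x -> ln x <= x - 1.
Proof.
by move=> x0; have := @le_ln1Dx R (x - 1); rewrite (addrC 1) subrK; apply; lra.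
Qed.

Lemma ln2_gt0 (R : realType) : 0 < ln 2 :> R.
Proof. by rewrite ln_gt0 // ltr1n. Qed.

(* Gibbs' inequality for the two-point distribution of weights
   2^(-l/beta) and 2^(-r/beta). *)
Lemma beta_gibbs (R : realType) (l r beta x y : R) :
  is_beta l r beta -> 0 < x -> 0 < y ->
  beta * ((x + y) * log2 (x + y)) <=
  l * x + r * y + beta * (x * log2 x) + beta * (y * log2 y).
Proof.
move=> [b0 bE] x0 y0; have xy0 : 0 < x + y by rewrite addr_gt0.
have n2 := ln2_gt0 R.
(* This is ln u <= u - 1 for u = 2^(-a / beta) (x + y) / z. In the sum of the instances for x and y
   the right sides cancel by the equation for [beta]. *)
have half (a z : R) : 0 < z ->
    z * (ln (x + y) - (a / beta) * ln 2 - ln z) <= 2 `^ (- (a / beta)) * (x + y) - z.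
  move=> z0.
  have p0 : 0 < 2 `^ (- (a / beta)) * (x + y) :> R by rewrite mulr_gt0 // powR_gt0.
  have u0 : 0 < 2 `^ (- (a / beta)) * (x + y) / z by rewrite divr_gt0.
  have := ln_le_sub1 u0.
  rewrite ln_div ?posrE // lnM ?posrE ?powR_gt0 // ln_powR => h.
  have := ler_wpM2l (ltW z0) h.
  rewrite [z * (_ - 1)]mulrBr [z * (_ / z)]mulrC divfK ?gt_eqF // mulr1.
  by apply: le_trans; rewrite ler_wpM2l ?(ltW z0) // mulNr; lra.
have h := lerD (half l x x0) (half r y y0).
have e0 : 2 `^ (- (l / beta)) * (x + y) - x + (2 `^ (- (r / beta)) * (x + y) - y) = 0.
  transitivity ((2 `^ (- (l / beta)) + 2 `^ (- (r / beta)) - 1) * (x + y)); first ring.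
  by rewrite bE subrr mul0r.
rewrite e0 in h; rewrite /log2.
have c0 : 0 < beta / ln 2 by rewrite divr_gt0.
have := ler_wpM2l (ltW c0) h; rewrite mulr0.
have E a z : beta / ln 2 * (z * (ln (x + y) - a / beta * ln 2 - ln z)) =
    beta * (z * (ln (x + y) / ln 2)) - a * z - beta * (z * (ln z / ln 2)).
  by field; rewrite !gt_eqF.
by rewrite mulrDr !E; lra.
Qed.

Lemma powR2_le_log2 (R : realType) (a : R) n : 2 `^ a <= n.+1%:R -> a <= log2 n.+1%:R.
Proof.
move=> h; rewrite ler_pdivlMr ?ln2_gt0 // -ln_powR.
by rewrite ler_ln ?posrE ?powR_gt0 // ltr0n.
Qed.

(** If level m has fewer than [n] nodes, its size estimate gives (m - 1) l <= beta log2 n. So the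
    charge (m + 1) l + r per step on level m + 1 is at most beta log2 n + 2 l + r. *)
Lemma uniform_cost_linear_rate (R : realType) (l r beta mu : R) fuel n :
  is_beta l r beta -> 0 < l -> 0 < r -> mu <= l -> mu <= r ->
  (forall i, i%:R * l - r < mu * (fuel i)%:R) -> exists2 m,
  (n <= tsize (linear_tree l r fuel m))%N &
  (uniform_cost (@f_linear R) l r (prefix_tree (linear_tree l r fuel m) n)
    <= (beta * n%:R * log2 n%:R + (2 * l + r) * n%:R)%:E)%E.
Proof.
move=> [b0 bE] l0 r0 ml mr hf; case: (posnP n) => [->|n0].
  by exists 0%N => //; rewrite lee_fin !mulr0 mul0r addr0.
have [m nm] := @exists_level (linear_tree l r fuel) n
  (leq_tsize_left_nested _) erefl n0.
case/andP: (nm) => mn nm1; exists m.+1 => //.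
apply: (le_trans (uniform_cost_prefix_linear_le (ltW l0) (ltW r0) nm1)).
rewrite lee_fin.
have h := tsize_linear_tree_ge m b0 bE ml mr (ltW l0) hf.
case: n n0 mn {nm nm1} => // n _ mn.
have /powR2_le_log2 : 2 `^ ((m%:R - 1) * l / beta) <= n.+1%:R.
  by apply: le_trans h _; rewrite ler_nat.
rewrite ler_pdivrMr // => h2.
have -> : beta * n.+1%:R * log2 n.+1%:R + (2 * l + r) * n.+1%:R =
   n.+1%:R * (log2 n.+1%:R * beta + (2 * l + r)) by ring.
by rewrite ler_wpM2l // -(natr1 m); lra.
Qed.

Lemma expected_cost_linear_asymp (R : realType) (p : probability (R * R)%type R) (l r : R) :
  nonneg_bounded_support p -> 'E_p[fst]%E = l%:E -> 'E_p[snd]%E = r%:E ->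
  0 < l -> 0 < r ->
  exists B : online_algorithm R, forall beta : R, is_beta l r beta ->
    expected_cost_asymp p (@f_linear R) B (fun n => beta * n%:R * log2 n%:R).
Proof.
move=> suppp El Er l0 r0; pose mu := Num.min l r.
have mu0 : 0 < mu by rewrite lt_min l0 r0.
have ml : mu <= l by rewrite ge_min lexx.
have mr : mu <= r by rewrite ge_min lexx orbT.
(* A step lowers the budget by at least [mu]. The algorithm is built from [l] and [r] alone, before
   [beta] is introduced. *)
pose fuel i := (Num.trunc ((i%:R * l - r) / mu)).+1.
have hf i : i%:R * l - r < mu * (fuel i)%:R.
  by rewrite [mu * _]mulrC -ltr_pdivrMr //; exact: truncnS_gt.
exists (tree_algorithm R (fun i => budget_tree l r (fuel i) (i%:R * l - r))).
move=> beta bE d Omega P X iidX; have [b0 _] := bE.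
apply: (asymp_equiv_of_bounds (C := 2 * l + r) (g := fun n => beta * n%:R * log2 n%:R)).
- move=> n; apply: (expected_OPT_ge0 suppp (iidX n)); exact: f_linear_ge0.
- move=> n; apply: (expected_OPT_le_tree _ suppp (iidX n)).
  exact: f_linear_ge0.
- move=> n; have [m nm Hm] := uniform_cost_linear_rate n bE l0 r0 ml mr hf.
  rewrite (expected_tree_algorithm (m := m) suppp El Er (iidX n)) //.
  exact: f_linear_ge0.
- move=> eps /andP[eps0 eps1].
  have cl : (1 - eps) * l < l by nra.
  have cr : (1 - eps) * r < r by nra.
  have [C C0 H] := expected_OPT_linear_ge suppp El Er cl cr.
  exists C => n.
  (* The shift by one makes [beta_gibbs] with x = i + 1 and y = j + 1 the required recursion, and
     the factor 1 - eps matches the reduced means. *)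
  pose Phi n : R := (1 - eps) * (beta * (n.+1%:R * log2 n.+1%:R)).
  apply: le_trans (H _ _ _ n _ Phi (iidX n) _ _).
  + rewrite lee_fin lerD2r ler_wpM2l ?subr_ge0 ?(ltW eps1) // -mulrA ler_wpM2l ?(ltW b0) //.
    case: n => [|n]; first by rewrite mul0r mul1r /log2 ln1 mul0r.
    rewrite /log2 !mulrA ler_wpM2r ?invr_ge0 ?(ltW (ln2_gt0 R)) //.
    rewrite ler_pM ?ln_ge0 ?ler1n ?ler_nat //.
    by rewrite ler_ln ?posrE ?ltr0n // ler_nat.
  + by rewrite /Phi /log2 ln1 mul0r !mulr0.
  + move=> i j; rewrite /Phi.
    have := beta_gibbs bE (ltr0Sn R i) (ltr0Sn R j).
    rewrite -natrD addSn addnS => h.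
    have e1 : 0 <= 1 - eps by rewrite subr_ge0 ltW.
    have := ler_wpM2l e1 h; rewrite !mulrDr !mulrA; lra.
- move=> e e0.
  apply: filterS2 (nbhs_infty_ger (2 `^ (e * beta)^-1)) (nbhs_infty_ge 1%N) => -[|n] // Hn _.
  have eb : 0 < e * beta by rewrite mulr_gt0.
  have h := powR2_le_log2 Hn.
  have : 1 <= e * beta * log2 n.+1%:R by rewrite -ler_pdivrMl // mulr1.
  by move=> /(ler_wpM2r (ler0n R n.+1)); rewrite mul1r; lra.
Qed.

(** Intermediate value theorem in u = 1 / beta: the sum is 2 at u = 0, and at u = 1 / min(l, r) each
    of its terms is at most 1/2. *)
Lemma is_beta_exists (R : realType) (l r : R) : 0 < l -> 0 < r ->
  exists beta : R, is_beta l r beta.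
Proof.
move=> l0 r0; pose f u : R := 2 `^ (- (l * u)) + 2 `^ (- (r * u)).
have E2 (a u : R) : 2 `^ (- (a * u)) = expR (- (a * ln 2) * u).
  by rewrite /powR pnatr_eq0 /=; congr expR; ring.
have fE : f = fun u => expR (- (l * ln 2) * u) + expR (- (r * ln 2) * u).
  by apply/funext => u; rewrite /f !E2.
have cont : continuous f.
  rewrite fE => u; apply: cvgD; apply: continuous_comp; try exact: continuous_expR;
    exact: mulrl_continuous.
pose u1 := (Num.min l r)^-1.
have m0 : 0 < Num.min l r by rewrite lt_min l0 r0.
have u10 : 0 < u1 by rewrite invr_gt0.
have half (a : R) : Num.min l r <= a -> 2 `^ (- (a * u1)) <= 2^-1.
  move=> ma; rewrite -[leRHS](@powR_inv1 R) // ler_powR ?ler1n // lerN2.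
  by rewrite ler_pdivlMr // mul1r.
have f0 : f 0 = 2 by rewrite /f !mulr0 !oppr0 !powRr0.
have f1 : f u1 <= 1.
  rewrite /f; have h1 : Num.min l r <= l by rewrite ge_min lexx.
  have h2 : Num.min l r <= r by rewrite ge_min lexx orbT.
  by have := half l h1; have := half r h2; lra.
have [|c c01 fc] := IVT (v := 1) (ltW u10) (continuous_subspaceT cont).
  by rewrite ge_min le_max f1 f0 orbT /= ler1n.
have c0 : 0 < c.
  move: c01; rewrite in_itv /= le_eqVlt => /andP[/predU1P[c0|//] _].
  by move: fc; rewrite -c0 f0 => h; lra.
by exists c^-1; split; rewrite ?invr_gt0 // !invrK.
Qed.

(** * Constants *)

(** The induction step is (1 + 1/(K+1))^(K+1) <= e. The companion bound below uses (1 -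
    1/(K+2))^(K+2) <= 1/e in the same way. *)
Lemma expn_le_expR_fact (R : realType) K :
  K.+1%:R ^+ K <= expR 1 ^+ K * K`!%:R :> R.
Proof.
elim: K => [|K IH]; first by rewrite !expr0 fact0 mul1r.
have k0 : 0 < K.+1%:R :> R by rewrite ltr0n.
have h : K.+2%:R ^+ K.+1 <= K.+1%:R ^+ K.+1 * expR 1 :> R.
  have -> : K.+2%:R = K.+1%:R * (1 + K.+1%:R^-1) :> R.
    by rewrite mulrDr mulr1 mulfV ?gt_eqF // natr1.
  rewrite exprMn ler_wpM2l ?exprn_ge0 // -[X in expR X](@mulfV _ K.+1%:R) ?gt_eqF //.
  rewrite expRM_natl lerXn2r ?nnegrE ?expR_ge0 ?addr_ge0 ?invr_ge0 //.
  exact: expR_ge1Dx.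
apply: (le_trans h); rewrite exprS factS natrM [expR 1 ^+ K.+1]exprS.
have := ler_wpM2l (ltW (mulr_gt0 k0 (expR_gt0 1))) IH.
lra.
Qed.

Lemma expR_fact_le_expn (R : realType) K :
  expR 1 ^+ K * K`!%:R <= K.+1%:R ^+ K.+1 :> R.
Proof.
elim: K => [|K IH]; first by rewrite !expr0 fact0 mul1r expr1.
have k0 : 0 < K.+1%:R :> R by rewrite ltr0n.
have k2 : 0 < K.+2%:R :> R by rewrite ltr0n.
have h : expR 1 * K.+1%:R ^+ K.+2 <= K.+2%:R ^+ K.+2 :> R.
  have -> : K.+1%:R = K.+2%:R * (1 + - K.+2%:R^-1) :> R.
    by rewrite mulrDr mulr1 mulrN mulfV ?gt_eqF // -(natr1 K.+1) addrK.
  rewrite exprMn mulrCA ler_piMr ?exprn_ge0 //.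
  apply: (@le_trans _ _ (expR 1 * expR (- K.+2%:R^-1) ^+ K.+2)).
    rewrite ler_wpM2l ?expR_ge0 // lerXn2r ?nnegrE ?expR_ge0 //.
      by rewrite subr_ge0 invf_le1 // ler1n.
    exact: expR_ge1Dx.
  by rewrite -expRM_natl mulrN mulfV ?gt_eqF // -expRD subrr expR0.
apply: le_trans h; rewrite exprS factS natrM (exprS _ K.+1).
have := ler_wpM2l (ltW (mulr_gt0 (expR_gt0 1) k0)) IH.
lra.
Qed.

Lemma c_expn (R : realType) K : c_ R K.+1 ^+ K.+1 = K.+2%:R ^+ K.+1 / K.+1`!%:R.
Proof.
rewrite /c_ expr_div_n; congr (_ / _).
by rewrite -powR_mulrn ?powR_ge0 // -powRrM mulVf ?pnatr_eq0 // powRr1.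
Qed.

(** Both sides are compared after taking (K+1)-st powers. The lower bound is first raised to e
    (K+2)^(-1/(K+1)), whose power is e^(K+1) / (K+2). *)
Lemma c_bounds (R : realType) K :
  expR 1 * (1 - ln K.+2%:R / K.+1%:R) <= c_ R K.+1 <= expR 1.
Proof.
have c0 : 0 <= c_ R K.+1 by rewrite /c_ divr_ge0 ?powR_ge0.
have f0 : 0 < K.+1`!%:R :> R by rewrite ltr0n fact_gt0.
apply/andP; split; last first.
  rewrite -(@ler_pXn2r _ K.+1) ?nnegrE ?expR_ge0 // c_expn ler_pdivrMr //.
  exact: expn_le_expR_fact.
apply: (@le_trans _ _ (expR 1 * expR (- (ln K.+2%:R / K.+1%:R)))).
  by rewrite ler_wpM2l ?expR_ge0 // expR_ge1Dx.
rewrite -(@ler_pXn2r _ K.+1) ?nnegrE ?mulr_ge0 ?expR_ge0 // c_expn exprMn.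
rewrite -[expR (- _) ^+ _]expRM_natl mulrN [_ * (_ / _)]mulrC divfK ?pnatr_eq0 //.
rewrite expRN lnK ?posrE ?ltr0n // ler_pdivlMr // mulrAC ler_pdivrMr ?ltr0n //.
by rewrite -exprSr; exact: expR_fact_le_expn.
Qed.

Lemma cvg_c (R : realType) : c_ R K @[K --> \oo] --> expR 1.
Proof.
have e0 : 0 < expR 1 :> R by exact: expR_gt0.
apply/cvgrPdist_le => eps eps0.
pose d := eps / expR 1 / 2.
have d0 : 0 < d by rewrite !divr_gt0.
apply: filterS2 (nbhs_infty_ger ((2 * d - 1 - ln d) / d)) (nbhs_infty_ge 1%N) => -[|K] // HK _.
have /andP[h1 h2] := c_bounds R K.
rewrite ger0_norm ?subr_ge0 // lerBlDr -lerBlDl; apply: le_trans h1.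
have k0 : 0 < K.+1%:R :> R by rewrite ltr0n.
have k2 : 0 < K.+2%:R :> R by rewrite ltr0n.
rewrite mulrBr mulr1 lerD2l lerN2 -ler_pdivlMl // [_^-1 * _]mulrC ler_pdivrMr //.
(* Scaling by [d] before using the tangent line shows that ln(K + 2) is at most 2 d (K + 1) for
   large K. *)
have h := ln_le_sub1 (mulr_gt0 d0 k2).
rewrite lnM ?posrE // -(natr1 K.+1) in h.
rewrite ler_pdivrMr // in HK.
have -> : eps / expR 1 = 2 * d by rewrite /d; lra.
by rewrite -(natr1 K.+1); lra.
Qed.

(** For z = (M / beta) ln 2 and t = (m / beta) ln 2 the equation reads exp(-z) + exp(-t) = 1. Since
    t >= exp(-z) and t <= 2 exp(-z), the ratio M / m = z / t lies between z exp(z) / 2 and z exp(z).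
    So ln(1 + M / m) is between z / 2 and 2 z, while beta = M ln 2 / z and M <= M + m <= 2 M. *)
Lemma beta_bounds (R : realType) (M m beta : R) : 0 < m -> m <= M -> 0 < beta ->
  2 `^ (- (M / beta)) + 2 `^ (- (m / beta)) = 1 ->
  ln 2 / 4 * ((M + m) / ln (1 + M / m)) <= beta <=
  2 * ln 2 * ((M + m) / ln (1 + M / m)).
Proof.
move=> m0 mM b0.
have M0 : 0 < M by exact: lt_le_trans mM.
have n2 := ln2_gt0 R.
pose z := M / beta * ln 2; pose t := m / beta * ln 2.
have z0 : 0 < z by rewrite !mulr_gt0 ?invr_gt0.
have t0 : 0 < t by rewrite !mulr_gt0 ?invr_gt0.
have tz : t <= z.
  by rewrite ler_wpM2r ?(ltW n2) // ler_wpM2r ?invr_ge0 ?(ltW b0).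
have E (a : R) : 2 `^ (- (a / beta)) = expR (- (a / beta * ln 2)).
  by rewrite /powR pnatr_eq0 /= mulNr.
rewrite !E -/z -/t => sum1.
have x2 : expR (- z) <= 2^-1.
  by have : expR (- z) <= expR (- t); [rewrite ler_expR lerN2 | lra].
have ez := expR_gt0 (- z).
have xt : expR (- z) <= t.
  have : expR (- t) <= expR (- expR (- z)).
    by apply: le_trans (expR_ge1Dx _); lra.
  by rewrite ler_expR lerN2.
(* With x = exp(-z) <= 1/2: exp(-2x) <= 1 / (1 + 2x) <= 1 - x = exp(-t). *)
have tx : t <= 2 * expR (- z).
  have : expR (- (2 * expR (- z))) <= expR (- t).
    rewrite expRN; set x := expR (- z) in x2 ez sum1 *.
    have h1 := expR_ge1Dx (2 * x).
    have p1 : 0 < 1 + 2 * x by lra.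
    apply: (@le_trans _ _ (1 + 2 * x)^-1).
      by rewrite lef_pV2 ?posrE ?expR_gt0.
    by rewrite -[leLHS]mul1r ler_pdivrMr //; nra.
  by rewrite ler_expR lerN2.
have ln2half : 2^-1 <= ln 2 :> R.
  have := @ln_le_sub1 R 2^-1; rewrite lnV ?posrE //.
  by move=> /(_ ltac:(by rewrite invr_gt0)); lra.
have z2 : 2^-1 <= z.
  apply: (le_trans ln2half); rewrite -ler_expR lnK ?posrE //.
  by move: x2; rewrite expRN lef_pV2 ?posrE ?expR_gt0.
have rho : M / m = z / t.
  by rewrite /z /t; field; rewrite !gt_eqF.
have ezE : expR (- z) * expR z = 1 by rewrite -expRD addNr expR0.
have ez0 := expR_gt0 z.
have ztup : z / t <= z * expR z.
  rewrite ler_pdivrMr // -mulrA ler_peMr ?(ltW z0) //.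
  by rewrite -ezE mulrC ler_wpM2l ?(ltW ez0).
have ztlo : z * expR z / 2 <= z / t.
  rewrite ler_pdivlMr //.
  have h : expR z * t <= 2 by have := ler_wpM2l (ltW ez0) tx; lra.
  have := ler_wpM2l (ltW z0) h; lra.
have L0 : 0 < 1 + z / t by rewrite addr_gt0 ?divr_gt0.
have Lup : ln (1 + z / t) <= 2 * z.
  rewrite -ler_expR lnK ?posrE //.
  have -> : 2 * z = z + z by ring.
  rewrite expRD; have h1 := expR_ge1Dx z.
  have : expR z * (1 + z) <= expR z * expR z by rewrite ler_wpM2l ?(ltW ez0).
  have : 1 <= expR z by apply: le_trans h1; lra.
  lra.
have Llo : z / 2 <= ln (1 + z / t).
  rewrite -ler_expR lnK ?posrE //.
  have aa : expR z = expR (z / 2) * expR (z / 2) by rewrite -expRD; congr expR; lra.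
  (* The square gives exp(z / 2) <= 1 + exp(z) / 4, and z >= 1/2 bounds exp(z) / 4 by z exp(z) /
     2. *)
  have := sqr_ge0 (expR (z / 2) / 2 - 1).
  have : expR z / 4 <= z * expR z / 2.
    by have := ler_wpM2r (ltW ez0) z2; lra.
  rewrite expr2; rewrite aa in ztlo *; lra.
rewrite rho.
set L := ln _ in Lup Llo *.
have L1 : 0 < L by lra.
have -> : beta = M * ln 2 / z by rewrite /z; field; rewrite !gt_eqF.
rewrite !mulrA; apply/andP; split.
- rewrite ler_pdivrMr // [leRHS]mulrAC ler_pdivlMr //.
  have : (M + m) * z <= 4 * M * L by nra.
  by move=> /(ler_wpM2l (ltW n2)); lra.
- rewrite ler_pdivrMr // [leRHS]mulrAC ler_pdivlMr //.
  have : M * L <= 2 * (M + m) * z by nra.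
  by move=> /(ler_wpM2l (ltW n2)); lra.
Qed.

Theorem theorem4 (R : realType) :
  (forall (p : probability (R * R)%type R) (l r : R),
     nonneg_bounded_support p ->
     'E_p[fst]%E = l%:E -> 'E_p[snd]%E = r%:E -> 0 < l -> 0 < r ->
     (forall K : nat, (1 <= K)%N ->
        exists A : online_algorithm R,
          expected_cost_asymp p (f_atmost R K) A
            (fun n => l * K%:R * n%:R `^ (1 + K%:R^-1) / c_ R K)) /\
     (exists beta : R, is_beta l r beta) /\
     (exists B : online_algorithm R,
        forall beta : R, is_beta l r beta ->
          expected_cost_asymp p (@f_linear R) B
            (fun n => beta * n%:R * log2 n%:R))) /\
  (c_ R K @[K --> \oo] --> expR 1) /\
  (exists c C : R, [/\ 0 < c, 0 < C &
     forall l r beta : R, 0 < l -> 0 < r -> is_beta l r beta ->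
       let g := (l + r) / ln (1 + Num.max (l / r) (r / l)) in
       c * g <= beta <= C * g]).
Proof.
have n2 := ln2_gt0 R.
split; last split.
- move=> p l r suppp El Er l0 r0; split; last split.
  + by case=> // K _; exact: expected_cost_atmost_asymp suppp El Er l0.
  + exact: is_beta_exists.
  + exact: expected_cost_linear_asymp suppp El Er l0 r0.
- exact: cvg_c.
exists (ln 2 / 4), (2 * ln 2); split; [lra|lra|].
move=> l r beta l0 r0 [b0 bE] /=.
have [lr|rl] := leP l r.
  have -> : Num.max (l / r) (r / l) = r / l.
    apply/max_idPr; rewrite ler_pdivlMr // mulrAC ler_pdivrMr //.
    by rewrite ler_pM // ltW.
  by rewrite [l + r]addrC; apply: beta_bounds; rewrite // addrC.
have -> : Num.max (l / r) (r / l) = l / r.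
  apply/max_idPl; rewrite ler_pdivlMr // mulrAC ler_pdivrMr //.
  by rewrite ler_pM // ltW.
by apply: beta_bounds => //; exact: ltW.
Qed.
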